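(* Let $(\varepsilon,D(\varepsilon))$ be a semi-Dirichlet form on $L^2(E,\mu)$, where $\mu$ is a $\sigma$-finite measure on the Lusin measurable space $(E,\mathcal{B})$. Then there exists a (larger) Lusin topological space $E_1$, with Borel $\sigma$-algebra $\mathcal{B}_1$, such that $E\subset E_1$, $E\in\mathcal{B}_1$, $\mathcal{B}=\mathcal{B}_1|_E$, and $(\varepsilon,D(\varepsilon))$, regarded as a semi-Dirichlet form on $L^2(E_1,\overline{\mu})$, is quasi-regular, where $\overline{\mu}$ is the measure on $(E_1,\mathcal{B}_1)$ extending $\mu$ by zero on $E_1\setminus E$.
   Context: A Lusin topological space is a (Hausdorff) topological space that is the continuous one-to-one image of a Polish space; a Lusin measurable space is the image of a Polish space under a measurable isomorphism. $L^2$-spaces are real; $L^2(E_1,\overline{\mu})$ and $L^2(E,\mu)$ are identified via restriction to $E$. Semi-Dirichlet form (Ma–Röckner, Ma–Overbeck–Röckner): a bilinear form $\varepsilon$ on a dense linear subspace $D(\varepsilon)$ of $L^2(E,\mu)$, with $\varepsilon(u,u)\ge0$, such that, writing $\varepsilon_1(u,v)=\varepsilon(u,v)+(u,v)_{L^2}$, (i) $D(\varepsilon)$ is complete for the norm $\varepsilon_1(u,u)^{1/2}$; (ii) there is $K>0$ with $|\varepsilon_1(u,v)|\le K\varepsilon_1(u,u)^{1/2}\varepsilon_1(v,v)^{1/2}$ for all $u,v\in D(\varepsilon)$; (iii) for every $u\in D(\varepsilon)$, $u^+\wedge1\in D(\varepsilon)$ and $\varepsilon(u+u^+\wedge1,\,u-u^+\wedge1)\ge0$.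 Quasi-regularity on a topological space $E_1$ with measure $\overline{\mu}$: for closed $F\subset E_1$ let $D(\varepsilon)_F=\{u\in D(\varepsilon):u=0\ \overline{\mu}\text{-a.e. on }E_1\setminus F\}$. An $\varepsilon$-nest is an increasing sequence $(F_k)_k$ of closed sets such that $\bigcup_kD(\varepsilon)_{F_k}$ is dense in $D(\varepsilon)$ for the norm $\varepsilon_1(u,u)^{1/2}$. A set $N\subset E_1$ is $\varepsilon$-exceptional if $N\subset\bigcap_k(E_1\setminus F_k)$ for some $\varepsilon$-nest $(F_k)_k$. A function $f$ defined outside an $\varepsilon$-exceptional set is $\varepsilon$-quasi-continuous if there is an $\varepsilon$-nest $(F_k)_k$ such that $f$ is defined on $\bigcup_kF_k$ and $f|_{F_k}$ is continuous for each $k$. The form is quasi-regular if: (QR1) there exists an $\varepsilon$-nest consisting of compact sets; (QR2) there is an $\varepsilon_1^{1/2}$-dense subset of $D(\varepsilon)$ whose elements have $\varepsilon$-quasi-continuous $\overline{\mu}$-versions; (QR3) there exist $u_n\in D(\varepsilon)$, $n\in\mathbb{N}$, with $\varepsilon$-quasi-continuous $\overline{\mu}$-versions $\widetilde{u}_n$ and an $\varepsilon$-exceptional set $N\subset E_1$ such that $\{\widetilde{u}_n:n\in\mathbb{N}\}$ separates the points of $E_1\setminus N$. *)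

(* Defs.v *)
From HB Require Import structures.
From mathcomp Require Import all_boot all_order all_algebra.
From mathcomp Require Import all_classical all_reals all_analysis.

Set Implicit Arguments.
Unset Strict Implicit.
Unset Printing Implicit Defensive.

Import Order.TTheory GRing.Theory Num.Theory.
Import numFieldNormedType.Exports.

Local Open Scope classical_set_scope.
Local Open Scope ring_scope.

(** * Polish and Lusin spaces *)

Definition separable (T : topologicalType) : Prop :=
  exists2 A : set T, countable A & dense A.

(* A Polish space is one whose topology is that of some [metricType R]
   satisfying this predicate. *)
Definition complete_separable (R : realType) (P : metricType R) : Prop :=
  separable P /\
  forall F : set_system P, ProperFilter F -> cauchy F -> exists l : P, F --> l.

Definition lusin_topological_space (R : realType) (T : topologicalType) : Prop :=
  hausdorff_space T /\
  exists (P : metricType R) (f : P -> T),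
    [/\ complete_separable P, continuous f & set_bij [set: P] [set: T] f].

Definition lusin_measurable_space (R : realType) d (E : measurableType d) : Prop :=
  exists (P : metricType R) (f : P -> E),
    [/\ complete_separable P,
        set_bij [set: P] [set: E] f,
        forall A : set E, measurable A -> <<s @open P >> (f @^-1` A) &
        forall B : set P, <<s @open P >> B -> measurable (f @` B)].

Notation borelType T := (g_sigma_algebraType (@open T)).

(** * Semi-Dirichlet forms *)

(* A subspace of L^2 is given by the set [D] of all the representatives of its
   elements; a form on it is a function [eps] that respects almost everywhere
   equality on [D], and whose values outside of [D] are irrelevant. *)

Section semi_dirichlet.
Context d (T : measurableType d) (R : realType).
Variable mu : {measure set T -> \bar R}.
Variables (D : set (T -> R)) (eps : (T -> R) -> (T -> R) -> R).
Implicit Types u v w f : T -> R.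

Definition form1 u v : R := eps u v + \int[mu]_x (u x * v x).

Definition form1_norm u : R := Num.sqrt (form1 u u).

Definition form1_dense (S : set (T -> R)) : Prop :=
  S `<=` D /\
  forall u, D u -> forall e : R, 0 < e ->
    exists2 v, S v & form1_norm (u - v) < e.

Definition unit_contraction u : T -> R :=
  fun x => Num.min (Num.max (u x) 0) 1.

Record semi_dirichlet_form : Prop := SemiDirichletForm {
  sdf_L2 : forall u, D u -> u \in Lfun mu 2%:E ;
  sdf_dom_ae : forall u v, D u -> measurable_fun [set: T] v ->
    u = v %[ae mu] -> D v ;
  sdf_ae : forall u u' v v', D u -> D u' -> D v -> D v' ->
    u = u' %[ae mu] -> v = v' %[ae mu] -> eps u v = eps u' v' ;
  sdf_dom0 : D 0 ;
  sdf_dom_lin : forall (a : R) u v, D u -> D v -> D (a *: u + v) ;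
  sdf_dense : forall f, f \in Lfun mu 2%:E -> forall e : R, 0 < e ->
    exists2 u, D u & ('N[mu]_(2%:E)[EFin \o (f - u)%R] < e%:E)%E ;
  sdf_linl : forall (a : R) u v w, D u -> D v -> D w ->
    eps (a *: u + v) w = a * eps u w + eps v w ;
  sdf_linr : forall (a : R) u v w, D u -> D v -> D w ->
    eps w (a *: u + v) = a * eps w u + eps w v ;
  sdf_ge0 : forall u, D u -> 0 <= eps u u ;
  sdf_complete : forall u_ : nat -> T -> R, (forall n, D (u_ n)) ->
    (forall e : R, 0 < e -> exists N : nat, forall m n : nat,
       (N <= m)%N -> (N <= n)%N -> form1_norm (u_ m - u_ n) < e) ->
    exists2 u, D u & form1_norm (u_ n - u) @[n --> \oo] --> (0 : R) ;
  sdf_sector : exists2 K : R, 0 < K & forall u v, D u -> D v ->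
    `|form1 u v| <= K * form1_norm u * form1_norm v ;
  sdf_dom_contraction : forall u, D u -> D (unit_contraction u) ;
  sdf_contraction : forall u, D u ->
    0 <= eps (u + unit_contraction u) (u - unit_contraction u)
}.

End semi_dirichlet.

(** * Quasi-regularity *)

Section quasi_regular.
Context (R : realType) (T : ptopologicalType).
Variable mu : {measure set (borelType T) -> \bar R}.
Variables (D : set (T -> R)) (eps : (T -> R) -> (T -> R) -> R).

Definition dom_on (F : set T) : set (T -> R) :=
  [set u | D u /\ {ae mu, forall x, (~` F) x -> u x = 0}].

Definition nest (F : nat -> set T) : Prop :=
  [/\ forall k, closed (F k),
      nondecreasing_seq F &
      form1_dense mu D eps (\bigcup_k dom_on (F k))].

Definition exceptional (N : set T) : Prop :=
  exists2 F : nat -> set T, nest F & N `<=` \bigcap_k ~` F k.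

(* A partially defined function is a pair of a domain [A] and a total function
   [f] whose values outside of [A] are irrelevant. That [~` A] is exceptional
   follows from the inclusion of the nest in [A]. *)
Definition quasi_continuous (A : set T) (f : T -> R) : Prop :=
  exists F : nat -> set T,
    [/\ nest F, \bigcup_k F k `<=` A & forall k, {within F k, continuous f}].

Definition ae_version (A : set T) (f u : T -> R) : Prop :=
  {ae mu, forall x, A x /\ f x = u x}.

Definition QR1 : Prop := exists2 F, nest F & forall k, compact (F k).

Definition QR2 : Prop :=
  exists2 S : set (T -> R), form1_dense mu D eps S &
    forall u, S u -> exists A f, quasi_continuous A f /\ ae_version A f u.

Definition QR3 : Prop :=
  exists (u : nat -> T -> R) (A : nat -> set T) (f : nat -> T -> R) (N : set T),
    [/\ forall n, D (u n),
        forall n, quasi_continuous (A n) (f n) /\ ae_version (A n) (f n) (u n),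
        exceptional N,
        forall n, ~` N `<=` A n &
        forall x y, (~` N) x -> (~` N) y -> x <> y ->
          exists n, f n x <> f n y].

Definition quasi_regular : Prop := [/\ QR1, QR2 & QR3].

End quasi_regular.

(** * Transport along the inclusion [i : E -> E1] *)

Section extension.
Context d (E : measurableType d) (R : realType) (E1 : ptopologicalType).
Variable i : E -> E1.

Definition extension_by_zero (mu : {measure set E -> \bar R})
    (mubar : {measure set (borelType E1) -> \bar R}) : Prop :=
  (forall A : set E, measurable A -> mubar (i @` A) = mu A) /\
  mubar (~` range i) = 0%E.

Definition extension_dom (mubar : {measure set (borelType E1) -> \bar R})
    (D : set (E -> R)) : set (borelType E1 -> R) :=
  [set u | u \in Lfun mubar 2%:E /\ D (u \o i)].

Definition extension_form (eps : (E -> R) -> (E -> R) -> R)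
    (u v : borelType E1 -> R) : R :=
  eps (u \o i) (v \o i).

End extension.

(* Main.v *)
Require Import Defs.
From HB Require Import structures.
From mathcomp Require Import all_boot all_order all_algebra.
From mathcomp Require Import all_classical all_reals all_analysis.
From mathcomp Require Import measurable_realfun.
From mathcomp Require Import ring lra.
Import Order.TTheory GRing.Theory Num.Theory.
Import numFieldNormedType.Exports.
Local Open Scope classical_set_scope.
Local Open Scope ring_scope.

Set Implicit Arguments.
Unset Strict Implicit.
Unset Printing Implicit Defensive.

(** Quasi-regularity is a property of the form and of a topology, and here the
    topology may be chosen. Take a sequence of bounded functions [u n] of the
    domain, with [`|u n x| <= b n], and let [U x] be the sequence of the
    [u n x]. It takes its values in the box of the real sequences [y] with
    [`|y n| <= b n], which is compact by Tychonoff's theorem; the coordinates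
    are continuous on the box, separate its points, and pull back along [U] to
    the [u n]. If the combinations of the [u n] are dense in the domain for the
    form norm, the constant nest equal to the box therefore satisfies the three
    conditions of quasi-regularity ([quasi_regular_image]).

    Such a sequence exists by [countable_core], and the tool for it is
    [form1_closure_bounded]: a sequence that is bounded for the form norm and
    converges in L2 to [u] has convex combinations that converge to [u] for the
    form norm. Applied to truncations, whose form norms are bounded thanks to
    the contraction property and the sector condition, it shows that bounded
    functions are dense ([bounded_dom_dense]). Applied to a countable subset of
    a form-bounded set, it turns the separability of L2 ([L2_separable]) into
    that of the domain.

    It remains to make [E] a Borel subset of the larger space. The [u n] are
    dense in L2, hence they generate the sigma-algebra of [E] up to null sets
    ([approx_measurable]). Off a null set [N], the points of [E], seen in a
    Polish space [P], can then be recovered measurably from their images by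
    [U]; so [U] is injective off [N] and maps measurable sets there to Borel
    sets ([measurable_image_off_null]). The larger space is the product of [P]
    and of the space of real sequences, which is Polish. The points off [N] are
    sent into the box, over a fixed point of [P]; a point [x] of [N] is sent
    out of the box, over [x] itself, where everything is exceptional. The
    measure is the image of [mu], and the form is carried over unchanged
    ([semi_dirichlet_image]). *)

(** * Semi-inner products on a subspace *)

Section semi_inner.
Context (R : realType) (V : lmodType R).
Variables (D : set V) (B : V -> V -> R).

(** A semi-Dirichlet form is not symmetric; the estimates below concern the
    quadratic form [B u u] and go through the symmetrised form
    [B u v + B v u]. *)
Record semi_inner : Prop := SemiInner {
  si_dom0 : D 0 ;
  si_dom_lin : forall (a : R) u v, D u -> D v -> D (a *: u + v) ;
  si_linl : forall (a : R) u v w, D u -> D v -> D w ->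
    B (a *: u + v) w = a * B u w + B v w ;
  si_linr : forall (a : R) u v w, D u -> D v -> D w ->
    B w (a *: u + v) = a * B w u + B w v ;
  si_ge0 : forall u, D u -> 0 <= B u u
}.

Definition qnorm u : R := Num.sqrt (B u u).

Hypothesis hB : semi_inner.

Lemma si_domD u v : D u -> D v -> D (u + v).
Proof. by move=> Du Dv; rewrite -[u]scale1r; apply: si_dom_lin. Qed.

Lemma si_domZ a u : D u -> D (a *: u).
Proof.
by move=> Du; rewrite -[_ *: _]addr0; apply: si_dom_lin => //; exact: si_dom0.
Qed.

Lemma si_domN u : D u -> D (- u).
Proof. by move=> Du; rewrite -scaleN1r; exact: si_domZ. Qed.

Lemma si_domB u v : D u -> D v -> D (u - v).
Proof. by move=> Du Dv; apply: si_domD => //; exact: si_domN. Qed.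

Lemma si_0l w : D w -> B 0 w = 0.
Proof.
move=> Dw; have D0 := si_dom0 hB.
by have := si_linl hB 1 D0 D0 Dw; rewrite scaler0 addr0 mul1r => ?; lra.
Qed.

Lemma si_0r w : D w -> B w 0 = 0.
Proof.
move=> Dw; have D0 := si_dom0 hB.
by have := si_linr hB 1 D0 D0 Dw; rewrite scaler0 addr0 mul1r => ?; lra.
Qed.

Let combl a b u v w : D u -> D v -> D w ->
  B (a *: u + b *: v) w = a * B u w + b * B v w.
Proof.
move=> Du Dv Dw; rewrite (si_linl hB)//; last exact: si_domZ.
rewrite -[b *: v]addr0 (si_linl hB) ?si_0l ?addr0//; exact: si_dom0.
Qed.

Let combr a b u v w : D u -> D v -> D w ->
  B w (a *: u + b *: v) = a * B w u + b * B w v.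
Proof.
move=> Du Dv Dw; rewrite (si_linr hB)//; last exact: si_domZ.
rewrite -[b *: v]addr0 (si_linr hB) ?si_0r ?addr0//; exact: si_dom0.
Qed.

Lemma si_quadratic a b u v : D u -> D v ->
  B (a *: u + b *: v) (a *: u + b *: v) =
  a ^+ 2 * B u u + a * b * (B u v + B v u) + b ^+ 2 * B v v.
Proof.
move=> Du Dv; have Dw : D (a *: u + b *: v).
  by apply: si_domD; exact: si_domZ.
by rewrite combl// !combr//; ring.
Qed.

Lemma qnorm_ge0 u : 0 <= qnorm u. Proof. exact: sqrtr_ge0. Qed.

Lemma sqr_qnorm u : D u -> qnorm u ^+ 2 = B u u.
Proof. by move=> Du; rewrite sqr_sqrtr// si_ge0. Qed.

Lemma qnormZ a u : D u -> qnorm (a *: u) = `|a| * qnorm u.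
Proof.
move=> Du; have := si_quadratic a 0 Du (si_dom0 hB).
rewrite scaler0 addr0 /qnorm => ->.
by rewrite mulr0 !mul0r expr0n/= mul0r !addr0 sqrtrM ?sqr_ge0// sqrtr_sqr.
Qed.

Lemma qnormN u : D u -> qnorm (- u) = qnorm u.
Proof. by move=> Du; rewrite -scaleN1r qnormZ// normrN1 mul1r. Qed.

Lemma qnorm_distC u v : D u -> D v -> qnorm (u - v) = qnorm (v - u).
Proof. by move=> Du Dv; rewrite -opprB qnormN//; exact: si_domB. Qed.

Lemma cauchy_schwarz_sym u v : D u -> D v ->
  B u v + B v u <= 2 * qnorm u * qnorm v.
Proof.
move=> Du Dv; set p := qnorm u; set r := qnorm v; set c := B u v + B v u.
have p0 : 0 <= p := qnorm_ge0 u.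
have r0 : 0 <= r := qnorm_ge0 v.
have H a b : 0 <= a ^+ 2 * p ^+ 2 + a * b * c + b ^+ 2 * r ^+ 2.
  rewrite !sqr_qnorm// -si_quadratic//.
  by apply: si_ge0 => //; apply: si_domD => //; exact: si_domZ.
(* If one of the norms vanishes, a large multiple of that vector makes the
   mixed term dominate; otherwise the form is evaluated at
   [r *: u - p *: v]. *)
have [p00|pN0] := eqVneq p 0.
  rewrite p00 mulr0 mul0r leNgt; apply/negP => c0.
  have := H (- (r ^+ 2 + 1) / c) 1; rewrite p00 expr0n/= mulr0 add0r mulr1.
  by rewrite divfK ?gt_eqF// expr1n mul1r => ?; lra.
have [r00|rN0] := eqVneq r 0.
  rewrite r00 mulr0 leNgt; apply/negP => c0.
  have := H 1 (- (p ^+ 2 + 1) / c); rewrite r00 expr0n/= mulr0 addr0 mul1r.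
  by rewrite divfK ?gt_eqF// expr1n mul1r => ?; lra.
have pr0 : 0 < p * r by rewrite mulr_gt0// lt0r ?pN0 ?rN0.
rewrite leNgt; apply/negP => hc.
by have := H r (- p); nra.
Qed.

Lemma qnormD u v : D u -> D v -> qnorm (u + v) <= qnorm u + qnorm v.
Proof.
move=> Du Dv.
rewrite -(@ler_pXn2r _ 2)// ?nnegrE ?addr_ge0 ?qnorm_ge0//.
rewrite sqr_qnorm; last exact: si_domD.
have := si_quadratic 1 1 Du Dv; rewrite !scale1r => ->.
rewrite sqrrD !sqr_qnorm//; have := cauchy_schwarz_sym Du Dv.
by rewrite !expr1n !mul1r -mulr_natl => ?; lra.
Qed.

Lemma qnormB u v : D u -> D v -> qnorm (u - v) <= qnorm u + qnorm v.
Proof.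
by move=> Du Dv; rewrite -(qnormN Dv); apply: qnormD => //; exact: si_domN.
Qed.

Lemma qnorm_triangle v u w : D u -> D v -> D w ->
  qnorm (u - w) <= qnorm (u - v) + qnorm (v - w).
Proof.
move=> Du Dv Dw; rewrite -(subrKA v); apply: qnormD; exact: si_domB.
Qed.

Definition midpoint (u v : V) : V := 2^-1 *: u + 2^-1 *: v.

Definition midpoint_closed (W : set V) : Prop :=
  forall u v, W u -> W v -> W (midpoint u v).

Lemma parallelogram u v : D u -> D v ->
  B (u - v) (u - v) = 2 * B u u + 2 * B v v -
                      4 * B (midpoint u v) (midpoint u v).
Proof.
move=> Du Dv; have := si_quadratic 1 (-1) Du Dv; rewrite scale1r scaleN1r => ->.
by rewrite si_quadratic//; field.
Qed.

Lemma midpointBr u v w : midpoint u v - w = midpoint (u - w) (v - w).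
Proof.
rewrite /midpoint !scalerBr addrACA -opprD -scalerDl.
by rewrite (_ : 2^-1 + 2^-1 = 1 :> R) ?scale1r//; field.
Qed.

Lemma qnorm_midpoint u v (r : R) : D u -> D v -> qnorm u <= r -> qnorm v <= r ->
  qnorm (midpoint u v) <= r.
Proof.
move=> Du Dv ur vr; apply: le_trans (qnormD _ _) _; try exact: si_domZ.
by rewrite !qnormZ// ger0_norm//; lra.
Qed.

End semi_inner.

(** * Square-integrable functions *)

Section L2.
Context d (T : measurableType d) (R : realType).
Variable mu : {measure set T -> \bar R}.
Implicit Types u v f g : T -> R.

Definition L2 : set (T -> R) := [set f | f \in Lfun mu 2%:E].

Definition l2prod u v : R := \int[mu]_x (u x * v x).

Notation l2norm := (qnorm l2prod).

Lemma L2P f : L2 f <->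
  measurable_fun [set: T] f /\ (\int[mu]_x (f x ^+ 2)%:E < +oo)%E.
Proof.
rewrite /L2/=; split=> [f2|[mf f2]].
  split; first by have := sub_Lfun_mfun f2; rewrite inE.
  have /integrableP[_] := Lfun2_integrable_sqr f2.
  by under eq_integral do rewrite /= ger0_norm ?sqr_ge0//.
apply/andP; split; first by rewrite inE.
rewrite inE/= /finite_norm unlock poweR_lty//.
under eq_integral => x _ do rewrite /= powR_mulrn// real_normK ?num_real//.
exact: f2.
Qed.

Lemma L2_measurable f : L2 f -> measurable_fun [set: T] f.
Proof. by case/L2P. Qed.

Lemma L2_integrable_prod u v : L2 u -> L2 v ->
  mu.-integrable setT (EFin \o (fun x => u x * v x)).
Proof. by move=> Lu Lv; apply/Lfun1_integrable; exact: Lfun2_mul_Lfun1. Qed.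

Lemma L2_dom_lin (a : R) u v : L2 u -> L2 v -> L2 (a *: u + v).
Proof.
have e1 : (1 <= 2%:E :> \bar R)%E by rewrite lee_fin ler1n.
by rewrite /L2/= => Lu Lv; apply: (Lfun_submod_closed mu e1).2.
Qed.

Lemma L2_semi_inner : semi_inner L2 l2prod.
Proof.
have L20 : L2 0.
  apply/L2P; split; first exact: measurable_cst.
  by under eq_integral do rewrite expr0n/=; rewrite integral0.
have lin a u v w : L2 u -> L2 v -> L2 w ->
    l2prod (a *: u + v) w = a * l2prod u w + l2prod v w.
  move=> Lu Lv Lw; have Lauv : L2 (a *: u) by rewrite -[a *: u]addr0; apply: L2_dom_lin.
  rewrite /l2prod -RintegralZl//; last exact: L2_integrable_prod.
  rewrite -RintegralD//; last exact: L2_integrable_prod.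
    by apply: eq_Rintegral => x _; rewrite /= mulrDl mulrA.
  have := L2_integrable_prod Lauv Lw.
  by apply: eq_integrable => // x _ /=; rewrite -mulrA.
have sym u v : l2prod u v = l2prod v u.
  by apply: eq_Rintegral => x _; rewrite mulrC.
split => //.
- exact: L2_dom_lin.
- by move=> a u v w Lu Lv Lw; rewrite !(sym w) lin.
- by move=> u _; apply: Rintegral_ge0 => x _; rewrite -expr2 sqr_ge0.
Qed.

Lemma l2prodE u : L2 u -> (l2prod u u)%:E = (\int[mu]_x (u x ^+ 2)%:E)%E.
Proof.
move=> /L2P[_ u2]; rewrite /l2prod /Rintegral.
rewrite fineK; first by [].
rewrite ge0_fin_numE//; apply: integral_ge0 => x _.
by rewrite lee_fin -expr2 sqr_ge0.
Qed.

Lemma Lnorm2E u : L2 u -> ('N[mu]_(2%:E)[EFin \o u] = (l2norm u)%:E)%E.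
Proof.
move=> Lu; rewrite unlock /Lnorm.
under eq_integral => x _ do rewrite /= powR_mulrn// real_normK ?num_real//.
rewrite -l2prodE//= /qnorm; congr (_%:E); rewrite powR12_sqrt//.
exact: si_ge0 L2_semi_inner _ Lu.
Qed.

Lemma L2_le u v : measurable_fun [set: T] v -> (forall x, `|v x| <= `|u x|) ->
  L2 u -> L2 v /\ l2prod v v <= l2prod u u.
Proof.
move=> mv vu Lu; have /L2P[mu_ u2] := Lu.
have le2 : (\int[mu]_x (v x ^+ 2)%:E <= \int[mu]_x (u x ^+ 2)%:E)%E.
  apply: ge0_le_integral => //.
  - by move=> x _; rewrite lee_fin sqr_ge0.
  - by apply/measurable_EFinP; exact: measurable_funX.
  - by apply/measurable_EFinP; exact: measurable_funX.
  - move=> x _; rewrite lee_fin -(real_normK (num_real (v x))).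
    by rewrite -(real_normK (num_real (u x))) ler_sqr ?nnegrE.
have Lv : L2 v by apply/L2P; split=> //; exact: le_lt_trans u2.
by split=> //; rewrite -lee_fin !l2prodE.
Qed.

Lemma L2_ae u v : measurable_fun [set: T] v -> u = v %[ae mu] ->
  L2 u -> L2 v /\ l2prod v v = l2prod u u.
Proof.
move=> mv uv Lu; have /L2P[mu_ u2] := Lu.
have e2 : (\int[mu]_x (v x ^+ 2)%:E = \int[mu]_x (u x ^+ 2)%:E)%E.
  apply: ge0_ae_eq_integral => //.
  - by apply/measurable_EFinP; exact: measurable_funX.
  - by apply/measurable_EFinP; exact: measurable_funX.
  - by move=> x _; rewrite lee_fin sqr_ge0.
  - by move=> x _; rewrite lee_fin sqr_ge0.
  - by apply: filterS uv => x + _ => ->.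
have Lv : L2 v by apply/L2P; rewrite e2.
by split=> //; apply/EFin_inj; rewrite !l2prodE.
Qed.

Lemma l2norm0_ae u : L2 u -> l2norm u = 0 -> u = 0 %[ae mu].
Proof.
move=> Lu u0; have := Lnorm2E Lu; rewrite u0 => /Lnorm_eq0_eq0 h.
have : EFin \o u = \0 %[ae mu].
  by apply: h => //; apply/measurable_EFinP; exact: L2_measurable.
by apply: filterS => x /(_ I)[->].
Qed.

Lemma l2norm_dominated (g : nat -> T -> R) f :
  (forall n, measurable_fun [set: T] (g n)) -> L2 f ->
  (forall n x, `|g n x| <= `|f x|) -> (forall x, g n x @[n --> \oo] --> f x) ->
  l2norm (g n - f) @[n --> \oo] --> (0 : R).
Proof.
move=> mg Lf gf cvgf; have mf := L2_measurable Lf.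
have Lg n : L2 (g n) by case: (L2_le (mg n) (gf n) Lf).
have Lgf n : L2 (g n - f) by exact: si_domB L2_semi_inner _ _ (Lg n) Lf.
have m2 n : measurable_fun setT (fun x => ((g n x - f x) ^+ 2)%:E : \bar R).
  apply/measurable_EFinP; apply: measurable_funX.
  exact: measurable_funB.
have : (\int[mu]_x ((g n x - f x) ^+ 2)%:E @[n --> \oo] -->
        \int[mu]_x (cst 0 x : \bar R))%E.
  have If : mu.-integrable [set: T] (fun x => (4 * (f x ^+ 2))%:E).
    have := integrableZl measurableT 4 (Lfun2_integrable_sqr Lf).
    by apply: eq_integrable => // x _.
  have cv : {ae mu, forall x, [set: T] x ->
      ((g n x - f x) ^+ 2)%:E @[n --> \oo] --> (0%E : \bar R)}.
    apply: aeW => x _; apply: cvg_EFin; first by apply: nearW.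
    rewrite [X in _ --> X](_ : 0 = (f x - f x) ^+ 2); last by rewrite subrr expr0n.
    have : g n x - f x @[n --> \oo] --> f x - f x.
      by apply: cvgB => //; exact: cvg_cst.
    by move=> h; rewrite expr2 /comp/=; under eq_cvg do rewrite expr2; exact: cvgM.
  have bd : {ae mu, forall x n, [set: T] x ->
      (`|((g n x - f x) ^+ 2)%:E| <= (4 * (f x ^+ 2))%:E)%E}.
    apply: aeW => x n _; rewrite gee0_abs ?lee_fin ?sqr_ge0//.
    have : `|g n x - f x| <= 2 * `|f x|.
      by rewrite (le_trans (ler_normB _ _))// mulr2n mulrDl mul1r lerD2r.
    move=> h; rewrite ?lee_fin -(real_normK (num_real (g n x - f x))).
    by rewrite -(real_normK (num_real (f x))); have := normr_ge0 (g n x - f x); nra.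
  by have [_ _] := dominated_convergence measurableT m2
    (measurable_cst (0%E : \bar R)) cv If bd.
rewrite integral0 => h.
have : l2prod (g n - f) (g n - f) @[n --> \oo] --> (0 : R).
  have : (l2prod (g n - f) (g n - f))%:E @[n --> \oo] --> (0%:E : \bar R).
    by under eq_cvg do rewrite (l2prodE (Lgf _)).
  by move=> /fine_cvg.
move=> h2; rewrite -[X in _ --> X]sqrtr0 /qnorm.
by apply: (continuous_cvg _ _ h2); exact: sqrt_continuous.
Qed.

Lemma L2_indic A : measurable A -> (mu A < +oo)%E -> L2 \1_A.
Proof.
move=> mA muA; apply/L2P; split; first exact: measurable_indic.
rewrite [ltLHS](_ : _ = \int[mu]_x (\1_A x)%:E)%E.
  by rewrite integral_indic// setIT.
by apply: eq_integral => x _; rewrite indicE -natrX -mulnn mulnb andbb.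
Qed.

End L2.

Notation l2norm mu := (qnorm (l2prod mu)).

(** * Strong approximation from bounded sequences *)

Section form_norm.
Context d (T : measurableType d) (R : realType).
Variables (mu : {measure set T -> \bar R}).
Variables (D : set (T -> R)) (eps : (T -> R) -> (T -> R) -> R).
Hypothesis heps : semi_dirichlet_form mu D eps.
Implicit Types u v w : T -> R.

Notation form1 := (form1 mu eps).
Notation fnorm := (form1_norm mu eps).

Lemma dom_L2 u : D u -> L2 mu u. Proof. exact: sdf_L2 heps u. Qed.

Lemma form1_semi_inner : semi_inner D form1.
Proof.
have h2 := L2_semi_inner mu.
split=> [||a u v w Du Dv Dw|a u v w Du Dv Dw|u Du].
- exact: sdf_dom0 heps.
- by move=> a u v; exact: (sdf_dom_lin heps).
- rewrite /form1 (sdf_linl heps)// -!/(l2prod _ _ _).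
  by rewrite (si_linl h2); [ring|exact: dom_L2..].
- rewrite /form1 (sdf_linr heps)// -!/(l2prod _ _ _).
  by rewrite (si_linr h2); [ring|exact: dom_L2..].
- rewrite /form1 addr_ge0 ?(sdf_ge0 heps)// -/(l2prod _ _ _).
  by apply: (si_ge0 h2); exact: dom_L2.
Qed.

Let hD := form1_semi_inner.
Let h2 := L2_semi_inner mu.

Lemma l2norm_le_form1_norm u : D u -> l2norm mu u <= fnorm u.
Proof.
by move=> Du; apply: ler_wsqrtr; rewrite /form1 lerDr (sdf_ge0 heps).
Qed.

Lemma form1_norm_ae u v : D u -> D v -> u = v %[ae mu] -> fnorm u = fnorm v.
Proof.
move=> Du Dv uv; rewrite /form1_norm /form1; congr (Num.sqrt (_ + _)).
  exact: (sdf_ae heps Du Dv Du Dv uv uv).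
rewrite -!/(l2prod _ _ _).
by have [] := L2_ae (L2_measurable (dom_L2 Dv)) uv (dom_L2 Du).
Qed.

(** The Banach-Saks theorem, in a form that avoids weak compactness: the sets
    [C n] of iterated midpoints of the tails decrease, so the infima [m n] of
    the quadratic form on them increase to a finite limit, and the
    parallelogram law turns almost minimal elements of [C n] into a Cauchy
    sequence for the form norm. Its limit can only be [u], since [C n] shrinks
    to [u] in L2. *)
Lemma form1_closure_bounded (W : set (T -> R)) (u_ : nat -> T -> R) u (M : R) :
  W `<=` D -> midpoint_closed W -> (forall k, W (u_ k)) ->
  (forall k, fnorm (u_ k) <= M) -> L2 mu u ->
  l2norm mu (u_ k - u) @[k --> \oo] --> (0 : R) ->
  D u /\ forall e : R, 0 < e -> exists2 v, W v & fnorm (u - v) < e.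
Proof.
move=> WD Wmid Wu uM Lu u_u.
pose C n := [set v | forall W' : set (T -> R), midpoint_closed W' ->
  (forall k, (n <= k)%N -> W' (u_ k)) -> W' v].
have Cmid n : midpoint_closed (C n).
  by move=> v w Cv Cw W' W'mid W'u; apply: (W'mid); [exact: Cv|exact: Cw].
have Cu n : C n (u_ n) by move=> W' _; exact.
have CW n : C n `<=` W by move=> v; apply.
have CD n : C n `<=` D by move=> v /CW /WD.
have Cle n m : (n <= m)%N -> C m `<=` C n.
  by move=> nm v Cv W' W'mid W'u; apply: Cv => // k mk; apply/W'u/(leq_trans nm).
have C_L2 n r : (forall k, (n <= k)%N -> l2norm mu (u_ k - u) <= r) ->
    forall v, C n v -> l2norm mu (v - u) <= r.
  move=> ur v Cv; suff [] : D v /\ l2norm mu (v - u) <= r by [].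
  apply: (Cv [set w | D w /\ l2norm mu (w - u) <= r]) => [w w'|k nk] /=.
    move=> [Dw wr] [Dw' wr']; split.
      by apply: (si_domD hD); exact: (si_domZ hD).
    rewrite midpointBr; apply: (qnorm_midpoint h2) => //.
      by apply: (si_domB h2) => //; exact: dom_L2.
    by apply: (si_domB h2) => //; exact: dom_L2.
  by split; [exact: WD|exact: ur].
pose q v := form1 v v.
pose m n := inf (q @` C n).
have q0 v : D v -> 0 <= q v by move=> Dv; exact: (si_ge0 hD Dv).
have qlb n : lbound (q @` C n) 0 by move=> _ [v Cv <-]; exact/q0/(CD n).
have hinf n : has_inf (q @` C n).
  by split; [exists (q (u_ n)); exists (u_ n)|exists 0].
have m_le n v : C n v -> m n <= q v.
  by move=> Cv; apply: ge_inf; [exists 0|exists v].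
have m_homo n k : (n <= k)%N -> m n <= m k.
  move=> nk; apply: lb_le_inf; first exact: (hinf k).1.
  by move=> _ [v Cv <-]; apply: m_le; exact: Cle Cv.
have m_ub : has_sup (range m).
  split; first by exists (m 0%N), 0%N.
  exists (M ^+ 2) => _ [n _ <-]; apply: le_trans (m_le _ _ (Cu n)) _.
  rewrite /q -(sqr_qnorm hD); last exact: CD (Cu n).
  rewrite ler_pXn2r ?nnegrE ?qnorm_ge0//; first exact: uM.
  by apply: le_trans (uM n); exact: sqrtr_ge0.
have /choice[v_ v_P] : forall n, exists v, C n v /\ q v < m n + n.+1%:R^-1.
  move=> n; have [|_ [v Cv <-] h] := inf_adherent (eps := n.+1%:R^-1) _ (hinf n).
    by rewrite invr_gt0.
  by exists v.
have Cv n : C n (v_ n) by case: (v_P n).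
have Dv n : D (v_ n) by exact: CD (Cv n).
have qv n k : (n <= k)%N -> q (v_ n - v_ k) <= 2 * (m k - m n) + 4 * n.+1%:R^-1.
  move=> nk; rewrite /q (parallelogram hD)//.
  have := m_le n (midpoint (v_ n) (v_ k)) (Cmid _ _ _ (Cv n) (Cle _ _ nk _ (Cv k))).
  have := (v_P n).2; have := (v_P k).2; rewrite /q.
  have : k.+1%:R^-1 <= n.+1%:R^-1 :> R by rewrite lef_pV2 ?posrE// ler_nat.
  move: (k.+1%:R^-1) (n.+1%:R^-1) (form1 (midpoint _ _) _) => b a c *.
  lra.
have v_cauchy (e : R) : 0 < e -> exists N : nat, forall n k : nat,
    (N <= n)%N -> (N <= k)%N -> fnorm (v_ n - v_ k) < e.
  move=> e0; have e2 : 0 < e ^+ 2 / 4 by rewrite divr_gt0// exprn_gt0.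
  have [_ [N1 _ <-] hN1] := sup_adherent e2 m_ub.
  have [N2 hN2] : exists N : nat, N.+1%:R^-1 < e ^+ 2 / 8.
    have e8 : 0 < e ^+ 2 / 8 by rewrite divr_gt0// exprn_gt0.
    by have [N] := ltr_add_invr e8; rewrite add0r; exists N.
  have hn n k : (maxn N1 N2 <= n)%N -> (n <= k)%N -> fnorm (v_ n - v_ k) < e.
    rewrite geq_max => /andP[N1n N2n] nk.
    rewrite -(@ltr_pXn2r _ 2)// ?nnegrE ?qnorm_ge0 ?(ltW e0)//.
    rewrite (sqr_qnorm hD); last exact: (si_domB hD).
    apply: le_lt_trans (qv n k nk) _.
    have := m_homo _ _ N1n.
    have : m k <= sup (range m) by apply: ub_le_sup; [exact: m_ub.2|exists k].
    have : n.+1%:R^-1 <= N2.+1%:R^-1 :> R by rewrite lef_pV2 ?posrE// ler_nat.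
    move: hN1 hN2; move: (m k) (m n) (m N1) (sup _) => mk mn mN1 s.
    by move: (n.+1%:R^-1) (N2.+1%:R^-1) (e ^+ 2) => a b e'; lra.
  exists (maxn N1 N2) => n k Nn Nk; have [nk|/ltnW kn] := leqP n k.
    exact: hn.
  by rewrite [fnorm _](qnorm_distC hD)//; exact: hn.
have [w Dw v_w] := sdf_complete heps Dv v_cauchy.
have uw : w = u %[ae mu].
  have Lw := dom_L2 Dw.
  have : l2norm mu (w - u) = 0.
    apply/eqP; rewrite eq_le qnorm_ge0 andbT; apply/ler_addgt0Pl => e e0.
    have e20 : 0 < e / 2 by rewrite divr_gt0.
    have /cvgrPdist_lt /(_ _ e20) [N1 _ hN1] := v_w.
    have /cvgrPdist_lt /(_ _ e20) [N2 _ hN2] := u_u.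
    pose N := maxn N1 N2.
    have Lv : L2 mu (v_ N) by exact: dom_L2.
    rewrite addr0; apply: le_trans (qnorm_triangle h2 Lw Lv Lu) _.
    have : l2norm mu (v_ N - u) <= e / 2.
      apply: (C_L2 N) => // k Nk; apply: ltW; have := hN2 k.
      rewrite sub0r normrN ger0_norm ?qnorm_ge0//; apply => /=.
      by apply: leq_trans Nk; rewrite leq_maxr.
    have : l2norm mu (w - v_ N) <= e / 2.
      apply: le_trans (l2norm_le_form1_norm _) _; first exact: (si_domB hD).
      rewrite [fnorm _](qnorm_distC hD)//; apply: ltW; have := hN1 N.
      rewrite sub0r normrN ger0_norm ?qnorm_ge0//; apply => /=.
      exact: leq_maxl.
    by move=> *; lra.
  move=> /l2norm0_ae h; have : w - u = 0 %[ae mu].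
    by apply: h; exact: (si_domB h2).
  by apply: filterS => x /(_ I) /eqP + _; rewrite subr_eq0 => /eqP.
have Du : D u by apply: (sdf_dom_ae heps Dw (L2_measurable Lu) uw).
split=> // e e0; have /cvgrPdist_lt /(_ _ e0) [N _ hN] := v_w.
exists (v_ N); first exact: CW (Cv N).
rewrite (@form1_norm_ae _ (w - v_ N)).
- rewrite [fnorm _](qnorm_distC hD)//; have := hN N (leqnn _).
  by rewrite sub0r normrN ger0_norm ?qnorm_ge0.
- exact: (si_domB hD).
- exact: (si_domB hD).
- by apply: filterS uw => x /(_ I) + _ => wx /=; rewrite !fctE wx.
Qed.

End form_norm.

(** * Density of the bounded functions *)

Section bounded_dense.
Context d (T : measurableType d) (R : realType).
Variables (mu : {measure set T -> \bar R}).
Variables (D : set (T -> R)) (eps : (T -> R) -> (T -> R) -> R).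
Hypothesis heps : semi_dirichlet_form mu D eps.
Implicit Types u v w : T -> R.

Notation form1 := (form1 mu eps).
Notation fnorm := (form1_norm mu eps).
Let hD := form1_semi_inner heps.

Lemma unit_contractionE u x : unit_contraction u x = Num.min (Num.max (u x) 0) 1.
Proof. by []. Qed.

Lemma norm_unit_contraction u x : `|unit_contraction u x| <= `|u x|.
Proof.
rewrite unit_contractionE ger0_norm; last by rewrite le_min le_max lexx orbT ler01.
by rewrite ge_min ge_max ler_norm normr_ge0.
Qed.

(** Replacing the form by [form1] in the contraction inequality only adds the
    integral of [u ^+ 2 - c ^+ 2 >= 0]; then the sector condition bounds the
    two mixed terms. *)
Lemma form1_norm_contraction : exists2 M : R, 0 <= M &
  forall u, D u -> fnorm (unit_contraction u) <= M * fnorm u.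
Proof.
have [K K0 hK] := sdf_sector heps.
exists (2 * K + 1); first by rewrite addr_ge0// mulr_ge0// ltW.
move=> u Du; set c := unit_contraction u.
have Dc : D c by exact: sdf_dom_contraction heps _ Du.
have : 0 <= form1 (u + c) (u - c).
  rewrite addr_ge0 ?(sdf_contraction heps)//; apply: Rintegral_ge0 => x _ /=.
  rewrite !fctE [_ * _](_ : _ = `|u x| ^+ 2 - `|c x| ^+ 2); last first.
    by rewrite !real_normK ?num_real//; ring.
  by rewrite subr_ge0 ler_sqr ?nnegrE//; exact: norm_unit_contraction.
have -> : form1 (u + c) (u - c) =
    form1 u u - form1 u c + form1 c u - form1 c c.
  have DB := si_domB hD Du Dc.
  rewrite -[u + c]scale1r -[_ *: _]addr0.
  rewrite -{1}[u]scale1r -[u - c]addrC -scaleN1r.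
  rewrite addr0 scale1r !(si_linl hD)// ?(si_linr hD)//; first by ring.
  by apply: (si_dom_lin hD).
have := hK _ _ Du Dc; have := hK _ _ Dc Du.
rewrite -!(sqr_qnorm hD)// !ler_norml; change (qnorm form1) with fnorm.
have p0 : 0 <= fnorm u := sqrtr_ge0 _.
have r0 : 0 <= fnorm c := sqrtr_ge0 _.
rewrite -!/(form1_norm mu eps _); move: p0 r0.
move: (fnorm u) (fnorm c) (form1 c u) (form1 u c).
move=> p r a b p0 r0 /andP[_ aK] /andP[bK _] h; rewrite leNgt; apply/negP => pr.
have Kp : 0 <= K * p by rewrite mulr_ge0// ltW.
have r_gt0 : 0 < r by lra.
have : (2 * K + 1) * p * r < r * r by rewrite ltr_pM2r.
have : p * p <= p * r by apply: ler_wpM2l => //; lra.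
by rewrite !expr2 in h; lra.
Qed.

(** Written as a multiple of a unit contraction so that its form norm is
    bounded by a multiple of that of [u] that does not depend on [k]. *)
Definition truncation (k : nat) u : T -> R :=
  k.+1%:R *: unit_contraction (k.+1%:R^-1 *: u).

Lemma truncationE k u x :
  truncation k u x = Num.min (Num.max (u x) 0) k.+1%:R.
Proof.
have k0 : 0 <= k.+1%:R :> R by [].
rewrite /truncation !fctE unit_contractionE /GRing.scale/=.
by rewrite minr_pMr// maxr_pMr// mulr0 mulr1 mulrA divff// mul1r.
Qed.

Lemma truncation_bounded k u x : `|truncation k u x| <= k.+1%:R.
Proof.
rewrite truncationE ger0_norm; first by rewrite ge_min lexx orbT.
by rewrite le_min le_max lexx orbT/=.
Qed.

Lemma dom_truncation k u : D u -> D (truncation k u).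
Proof.
move=> Du; apply: (si_domZ hD); apply: (sdf_dom_contraction heps).
exact: (si_domZ hD).
Qed.

Definition pos_part u : T -> R := fun x => Num.max (u x) 0.

Lemma cvg_truncation u x : truncation k u x @[k --> \oo] --> pos_part u x.
Proof.
apply: cvg_near_cst; near=> k; rewrite truncationE /pos_part.
apply/min_idPl; near: k; exists (Num.truncn (pos_part u x)) => // k /= nk.
apply: ltW; apply: lt_le_trans (truncnS_gt _) _.
by rewrite ler_nat.
Unshelve. all: by end_near. Qed.

Definition bounded_dom : set (T -> R) :=
  [set v | D v /\ exists c : R, forall x, `|v x| <= c].

Lemma bounded_domB u v : bounded_dom u -> bounded_dom v -> bounded_dom (u - v).
Proof.
move=> [Du [a ua]] [Dv [b vb]]; split; first exact: (si_domB hD).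
by exists (a + b) => x; apply: le_trans (ler_normB _ _) _; exact: lerD.
Qed.

Lemma bounded_dom_midpoint : midpoint_closed bounded_dom.
Proof.
move=> u v [Du [a ua]] [Dv [b vb]]; split.
  by apply: (si_domD hD); exact: (si_domZ hD).
exists (a + b) => x; apply: le_trans (ler_normD _ _) _; apply: lerD.
  by rewrite normrM ger0_norm//; have := ua x; have := normr_ge0 (u x); lra.
by rewrite normrM ger0_norm//; have := vb x; have := normr_ge0 (v x); lra.
Qed.

(** The truncations of [u] are bounded for the form norm and converge to the
    positive part in L2, so [form1_closure_bounded] applies to them. *)
Lemma pos_part_closure u : D u -> D (pos_part u) /\
  forall e : R, 0 < e -> exists2 v, bounded_dom v & fnorm (pos_part u - v) < e.
Proof.
move=> Du; have [M M0 hM] := form1_norm_contraction.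
have Lu := dom_L2 heps Du.
have mu_ := L2_measurable Lu.
have mp : measurable_fun [set: T] (pos_part u).
  exact: measurable_maxr.
have Lp : L2 mu (pos_part u).
  apply: (L2_le mp _ Lu).1 => x; rewrite ger0_norm ?le_max ?lexx ?orbT//.
  by rewrite ge_max ler_norm normr_ge0.
apply: (form1_closure_bounded heps (u_ := truncation^~ u) (M := M * fnorm u)) => //.
- by move=> v [].
- exact: bounded_dom_midpoint.
- move=> k; split; first exact: dom_truncation.
  by exists k.+1%:R; exact: truncation_bounded.
- move=> k; rewrite /truncation [fnorm _](qnormZ hD); last first.
    by apply: (sdf_dom_contraction heps); exact: (si_domZ hD).
  rewrite ger0_norm//; have Dku : D (k.+1%:R^-1 *: u) by exact: (si_domZ hD).
  apply: le_trans (ler_wpM2l _ (hM _ Dku)) _ => //.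
  rewrite [fnorm _](qnormZ hD)// ger0_norm ?invr_ge0//.
  by rewrite mulrCA mulVKf.
- apply: l2norm_dominated => //.
  + by move=> k; apply: L2_measurable; apply: (dom_L2 heps); exact: dom_truncation.
  + move=> k x; rewrite truncationE.
    have p0 : 0 <= pos_part u x by rewrite le_max lexx orbT.
    by rewrite !ger0_norm ?ge_min ?lexx// le_min p0/=.
  + by move=> x; exact: cvg_truncation.
Qed.

Lemma bounded_dom_dense : form1_dense mu D eps bounded_dom.
Proof.
split=> [v []//|u Du e e0]; have e20 : 0 < e / 2 by rewrite divr_gt0.
have DNu : D (- u) by exact: (si_domN hD).
have [Dp /(_ _ e20)[v bv pv]] := pos_part_closure Du.
have [Dn /(_ _ e20)[w bw nw]] := pos_part_closure DNu.
exists (v - w); first exact: bounded_domB.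
have -> : u - (v - w) = (pos_part u - v) - (pos_part (- u) - w).
  apply/funext => x; rewrite !fctE /pos_part.
  have -> : Num.max (- u x) 0 = Num.max (u x) 0 - u x.
    by rewrite !maxEle; case: ifP; case: ifP => *; lra.
  by ring.
have Dv : D (pos_part u - v) by apply: (si_domB hD) => //; case: bv.
have Dw : D (pos_part (- u) - w) by apply: (si_domB hD) => //; case: bw.
by apply: le_lt_trans (qnormB hD Dv Dw) _; rewrite [e]splitr ltrD.
Qed.

End bounded_dense.

(** * Countable generation of Lusin measurable spaces *)

Section decode.
Context (T : countType) (t0 : T).

Definition decode (n : nat) : T := odflt t0 (unpickle n).

Lemma decode_surj t : exists n, decode n = t.
Proof. by exists (pickle t); rewrite /decode pickleK. Qed.

End decode.

Lemma measurable_preimage_gen d (X : measurableType d) (Y : Type)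
    (G : set (set Y)) (h : X -> Y) :
  (forall U, G U -> measurable (h @^-1` U)) ->
  forall B, <<s G >> B -> measurable (h @^-1` B).
Proof.
move=> hG; apply: (@smallest_sub _ _ _ [set B | measurable (h @^-1` B)]) => //.
split => /=; first by rewrite preimage_set0.
- by move=> A mA; rewrite setTD preimage_setC; exact: measurableC.
- by move=> A mA; rewrite preimage_bigcup; exact: bigcupT_measurable.
Qed.

Section separable_metric.
Context (R : realType) (P : metricType R).

Lemma metric_open_ball (x : P) (e : R) : open (ball x e).
Proof.
rewrite openE => y; rewrite ballEmdist/= => xy.
apply/nbhs_ballP; exists (e - mdist x y); first by rewrite /= subr_gt0.
move=> z; rewrite !ballEmdist/= => yz.
by apply: le_lt_trans (metric_triangle x y z) _; rewrite addrC -ltrBrDr.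
Qed.

Definition dense_seq (a : nat -> P) : Prop :=
  forall x (e : R), 0 < e -> exists n, ball (a n) e x.

Lemma separable_dense_seq (p0 : P) : separable P -> exists a, dense_seq a.
Proof.
move=> [A /countable_injP[g ginj] dA].
exists (fun n => xget p0 [set x | A x /\ g x = n]) => x e e0.
have [y [xy Ay]] : ball x e `&` A !=set0.
  apply: dA; last exact: metric_open_ball.
  by exists x; apply: ballxx.
exists (g y).
case: xgetP => [z _ [Az gz]|/(_ y)]; last by case.
have -> : z = y by apply: ginj; rewrite ?inE ?gz.
exact: ball_sym.
Qed.

Variable a : nat -> P.
Hypothesis ha : dense_seq a.

Lemma open_bigcup_ball (U : set P) : open U ->
  U = \bigcup_(nk in [set nk : nat * nat |
        ball (a nk.1) nk.2.+1%:R^-1 `<=` U]) ball (a nk.1) nk.2.+1%:R^-1.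
Proof.
move=> oU; apply/seteqP; split=> [x Ux|x [nk] /= + h]; last exact.
have /nbhs_ballP[e /= e0 eU] : nbhs x U by exact: open_nbhs_nbhs.
have [k] : exists k : nat, k.+1%:R^-1 < e / 2.
  have e20 : 0 < e / 2 by rewrite divr_gt0.
  by have [k] := ltr_add_invr e20; rewrite add0r; exists k.
move=> ke; have k0 : 0 < k.+1%:R^-1 :> R by rewrite invr_gt0.
have [n xn] := ha x k0; exists (n, k) => //= y ny; apply: eU.
apply: le_ball (ball_triangle (ball_sym xn) ny).
by rewrite [e]splitr lerD// ltW.
Qed.

Lemma measurable_preimage_balls d (X : measurableType d) (h : X -> P) :
  (forall n k, measurable (h @^-1` ball (a n) k.+1%:R^-1)) ->
  forall B, <<s @open P >> B -> measurable (h @^-1` B).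
Proof.
move=> hb; apply: measurable_preimage_gen => U oU.
rewrite (open_bigcup_ball oU) bigcup_mkcond preimage_bigcup.
apply: countable_bigcupT_measurable => [|nk]; first exact: countableP.
by case: ifP => _; [exact: hb|rewrite preimage_set0].
Qed.

End separable_metric.

Section lusin.
Context (R : realType) d (E : measurableType d).

Lemma lusin_inverse : lusin_measurable_space R E ->
  exists (P : metricType R) (f : P -> E) (g : E -> P),
    [/\ complete_separable P, cancel f g /\ cancel g f,
        forall A, measurable A -> <<s @open P >> (f @^-1` A) &
        forall B, <<s @open P >> B -> measurable (g @^-1` B)].
Proof.
move=> [P [f [cP fbij mf mf']]].
have [_ finj fsurj] := fbij.
have /choice[g fg] : forall x, exists p, f p = x.
  by move=> x; have [p _ fp] := fsurj x I; exists p.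
have gf : cancel f g by move=> p; apply: finj; rewrite ?inE// fg.
exists P, f, g; split=> // B sB; have -> : g @^-1` B = f @` B; last exact: mf'.
apply/seteqP; split=> [x Bx|_ [p Bp <-]]; last by rewrite /= gf.
by exists (g x).
Qed.

Lemma lusin_countably_generated : lusin_measurable_space R E ->
  exists B : nat -> set E, (forall n, measurable (B n)) /\
    forall A, measurable A -> <<s range B >> A.
Proof.
move=> /lusin_inverse[P [f [g [[sP _] [gf fg] mf mg]]]].
have [a ha] := separable_dense_seq (g point) sP.
pose B m := let nk := decode (0%N, 0%N) m in
  g @^-1` ball (a nk.1) nk.2.+1%:R^-1.
exists B; split=> [n|A mA].
  by apply: mg; apply: sub_sigma_algebra; exact: metric_open_ball.
have -> : A = g @^-1` (f @^-1` A) by apply/seteqP; split=> x /=; rewrite fg.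
apply: (@measurable_preimage_balls _ _ _ ha _ (g_sigma_algebraType (range B))).
  move=> n k; apply: sub_sigma_algebra.
  have [m hm] := decode_surj (0%N, 0%N) (n, k).
  by exists m => //; rewrite /B hm.
exact: mf.
Qed.

End lusin.

(** * Separability of L2 *)

Section L2_closure.
Context d (T : measurableType d) (R : realType).
Variable mu : {measure set T -> \bar R}.
Variables (I : Type) (g : I -> T -> R).
Hypothesis L2g : forall i, L2 mu (g i).

Let h2 := L2_semi_inner mu.

Definition rat_comb (s : seq (rat * I)) : T -> R :=
  \sum_(t <- s) ratr t.1 *: g t.2.

Lemma L2_rat_comb s : L2 mu (rat_comb s).
Proof.
rewrite /rat_comb; elim/big_ind: _ => [|u v|t _].
- exact: (si_dom0 h2).
- exact: (si_domD h2).
- exact: (si_domZ h2).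
Qed.

(** The coefficients are rational so that [rat_comb] ranges over a countable
    set; the closure is nevertheless a closed subspace over the reals. *)
Definition rat_closure : set (T -> R) := [set f | L2 mu f /\
  forall e : R, 0 < e -> exists s, l2norm mu (f - rat_comb s) < e].

Let W := rat_closure.

Lemma rat_closure_gen i : W (g i).
Proof.
split=> // e e0; exists [:: (1, i)].
rewrite /rat_comb big_seq1/= rmorph1 scale1r subrr /qnorm (si_0l h2) ?sqrtr0//.
exact: (si_dom0 h2).
Qed.

Lemma rat_closure0 : W 0.
Proof.
split=> [|e e0]; first exact: (si_dom0 h2).
exists [::]; rewrite /rat_comb big_nil subrr /qnorm (si_0l h2) ?sqrtr0//.
exact: (si_dom0 h2).
Qed.

Lemma rat_closureD u v : W u -> W v -> W (u + v).
Proof.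
move=> [Lu Wu] [Lv Wv]; split=> [|e e0]; first exact: (si_domD h2).
have e20 : 0 < e / 2 by rewrite divr_gt0.
have [s us] := Wu _ e20; have [t vt] := Wv _ e20; exists (s ++ t).
rewrite /rat_comb big_cat/= opprD addrACA.
have Lus := si_domB h2 Lu (L2_rat_comb s).
have Lvt := si_domB h2 Lv (L2_rat_comb t).
by apply: le_lt_trans (qnormD h2 Lus Lvt) _; rewrite [e]splitr ltrD.
Qed.

Lemma rat_closureZ (a : R) u : W u -> W (a *: u).
Proof.
move=> [Lu Wu]; split=> [|e e0]; first exact: (si_domZ h2).
have u0 := qnorm_ge0 (l2prod mu) u; set nu := qnorm _ _ in u0.
have del0 : 0 < e / 2 / (nu + 1).
  by rewrite !divr_gt0// ltr_wpDl.
have [q aq] : exists q : rat, `|a - ratr q| < e / 2 / (nu + 1).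
  have [q] := @rat_in_itvoo R (a - e / 2 / (nu + 1)) a ltac:(by rewrite ltrBlDr ltrDl).
  rewrite in_itv/= => /andP[h1 h3]; exists q.
  by rewrite ger0_norm ?subr_ge0 1?ltW// ltrBlDr addrC -ltrBlDr.
have q10 : 0 < `|ratr q : R| + 1 by rewrite ltr_wpDl.
have eq0 : 0 < e / 2 / (`|ratr q : R| + 1) by rewrite !divr_gt0.
have [s us] := Wu _ eq0; exists [seq (q * t.1, t.2) | t <- s].
have Lus := si_domB h2 Lu (L2_rat_comb s).
have -> : a *: u - rat_comb [seq (q * t.1, t.2) | t <- s] =
    (a - ratr q) *: u + ratr q *: (u - rat_comb s).
  rewrite /rat_comb big_map/= scalerBl scalerBr addrA subrK; congr (_ - _).
  by rewrite scaler_sumr; apply: eq_bigr => t _; rewrite scalerA rmorphM.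
apply: le_lt_trans (qnormD h2 (si_domZ h2 _ Lu) (si_domZ h2 _ Lus)) _.
rewrite !(qnormZ h2)// [e]splitr ltr_leD//.
  have : `|a - ratr q| * (nu + 1) < e / 2 by rewrite -ltr_pdivlMr// ltr_wpDl.
  by apply: le_lt_trans; rewrite ler_wpM2l// lerDl.
have : (`|ratr q| + 1) * l2norm mu (u - rat_comb s) < e / 2.
  by rewrite mulrC -ltr_pdivlMr.
by move/ltW; apply: le_trans; rewrite ler_wpM2r ?qnorm_ge0// lerDl.
Qed.

Lemma rat_closureB u v : W u -> W v -> W (u - v).
Proof.
by move=> Wu Wv; apply: rat_closureD => //; rewrite -scaleN1r; exact: rat_closureZ.
Qed.

Lemma rat_closure_sum (J : Type) (s : seq J) (u : J -> T -> R) :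
  (forall j, W (u j)) -> W (\sum_(j <- s) u j).
Proof.
by move=> Wu; elim/big_ind: _ => //; [exact: rat_closure0|exact: rat_closureD].
Qed.

Lemma rat_closure_lim (u : nat -> T -> R) f : L2 mu f -> (forall n, W (u n)) ->
  l2norm mu (u n - f) @[n --> \oo] --> (0 : R) -> W f.
Proof.
move=> Lf Wu uf; split=> // e e0; have e20 : 0 < e / 2 by rewrite divr_gt0.
have /cvgrPdist_lt /(_ _ e20) [N _ /(_ N (leqnn _))] := uf.
rewrite sub0r normrN ger0_norm ?qnorm_ge0// => uN.
have [LuN /(_ _ e20)[s us]] := Wu N; exists s.
apply: le_lt_trans (qnorm_triangle h2 Lf LuN (L2_rat_comb s)) _.
by rewrite [e]splitr (qnorm_distC h2)// ltrD.
Qed.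

End L2_closure.

Section L2_separable.
Context d (T : measurableType d) (R : realType).
Variable mu : {sigma_finite_measure set T -> \bar R}.
Variable B : nat -> set T.
Hypothesis mB : forall n, measurable (B n).
Hypothesis genB : forall A, measurable A -> <<s range B >> A.

Let h2 := L2_semi_inner mu.

(** Closing the generators under finite intersections yields a pi-system that
    is still countable. *)
Definition capB (s : seq nat) : set T := \big[setI/setT]_(i <- s) B i.

Lemma measurable_capB s : measurable (capB s).
Proof. by rewrite /capB; elim/big_ind: _ => // *; exact: measurableI. Qed.

Lemma measurable_gen_capB : @measurable _ T = <<s range capB >>.
Proof.
apply/seteqP; split=> [A /genB|].
  apply: smallest_sub; first exact: smallest_sigma_algebra.
  move=> _ [n _ <-]; apply: sub_sigma_algebra; exists [:: n] => //.
  by rewrite /capB big_seq1.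
apply: smallest_sub; first exact: sigma_algebra_measurable.
by move=> _ [s _ <-]; exact: measurable_capB.
Qed.

Variable F : nat -> set T.
Hypothesis coverF : [set: T] = \bigcup_i F i.
Hypothesis ndF : nondecreasing_seq F.
Hypothesis mF : forall i, measurable (F i) /\ (mu (F i) < +oo)%E.

Definition cap_indic (k : nat * seq nat) : T -> R := \1_(capB k.2 `&` F k.1).

Lemma L2_indicF A n : measurable A -> L2 mu (\1_(A `&` F n) : T -> R).
Proof.
move=> mA; apply: L2_indic; first exact: measurableI mA (mF n).1.
apply: le_lt_trans (mF n).2; apply: le_measure; rewrite ?inE//.
- exact: measurableI mA (mF n).1.
- exact: (mF n).1.
Qed.

Lemma L2_cap_indic k : L2 mu (cap_indic k).
Proof. exact: L2_indicF (measurable_capB _). Qed.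

Notation W := (rat_closure mu cap_indic).

(** Dynkin's pi-lambda theorem; the sets are cut by [F n], whose measure is
    finite, so that all the indicator functions are square-integrable. *)
Lemma rat_closure_indic n A : measurable A -> W (\1_(A `&` F n) : T -> R).
Proof.
move=> mA; have sA : <<s range capB >> A by rewrite -measurable_gen_capB.
move: A sA {mA}.
apply: (dynkin_induction measurable_gen_capB).
- move=> _ _ [s _ <-] [t _ <-]; exists (s ++ t) => //.
  by rewrite /capB big_cat.
- have := rat_closure_gen L2_cap_indic (n, [::]).
  by rewrite /cap_indic /capB big_nil.
- by move=> _ [s _ <-]; exact: (rat_closure_gen L2_cap_indic (n, s)).
- move=> A mA WA.
  rewrite [X in W X](_ : _ = \1_(setT `&` F n) - \1_(A `&` F n)).
    apply: (rat_closureB L2_cap_indic) => //.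
    have := rat_closure_gen L2_cap_indic (n, [::]).
    by rewrite /cap_indic /capB big_nil.
  apply/funext => x; rewrite !fctE !indicE !in_setI in_setC in_setT.
  by case: (x \in A); case: (x \in F n); rewrite ?subrr ?subr0.
- move=> A mA tA WA; pose U k := \big[setU/set0]_(i < k) A i.
  have mU k : measurable (U k) by apply: bigsetU_measurable.
  have WU k : W (\1_(U k `&` F n)).
    elim: k => [|k IH].
      rewrite [X in W X](_ : _ = 0); first exact: rat_closure0.
      by apply/funext => x; rewrite /U big_ord0 set0I indicE in_set0.
    rewrite [X in W X](_ : _ = \1_(U k `&` F n) + \1_(A k `&` F n)).
      exact: (rat_closureD L2_cap_indic).
    apply/funext => x; rewrite !fctE !indicE !in_setI /U big_ord_recr/= in_setU.
    have [xA|] := boolP (x \in A k); last by rewrite orbF addr0.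
    suff /negbTE -> : x \notin U k by rewrite /= add0r.
    apply/negP; rewrite !inE /U -bigcup_mkord => -[i /= ik Ai].
    have /trivIsetP/(_ i k I I) := tA; rewrite ltn_eqF// => /(_ isT) AiAk.
    by have : set0 x by rewrite -AiAk; split=> //; rewrite inE in xA.
  apply: (rat_closure_lim L2_cap_indic (u := fun k => \1_(U k `&` F n))) => //.
    by apply: L2_indicF; exact: bigcupT_measurable.
  have UA k x : U k x -> (\bigcup_k A k) x.
    by rewrite /U -bigcup_mkord => -[i _ Ai]; exists i.
  apply: (l2norm_dominated (g := fun k => \1_(U k `&` F n))) => [k||k x|x].
  + by have [/L2_measurable] := WU k.
  + by apply: L2_indicF; apply: bigcupT_measurable.
  + rewrite !indicE !in_setI !ger0_norm// ler_nat.
    have [/[!inE] /UA Ax|//] := boolP (x \in U k).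
    by rewrite (mem_set Ax).
  + rewrite indicE in_setI; apply: cvg_near_cst.
    have [/[!inE] -[i _ Ai]|nA] := boolP (x \in \bigcup_k A k).
      exists i.+1 => // k /= ik; rewrite indicE in_setI mem_set//.
      by rewrite /U -bigcup_mkord; exists i.
    apply: nearW => k; rewrite indicE in_setI (negbTE (_ : x \notin U k))//.
    by apply: contra nA; rewrite !inE; exact: UA.
Qed.

Import HBNNSimple.

Lemma rat_closure_ge0 f : L2 mu f -> (forall x, 0 <= f x) -> W f.
Proof.
move=> Lf f0; have mf := L2_measurable Lf.
have mef : measurable_fun [set: T] (EFin \o f) by exact/measurable_EFinP.
have ef0 x : [set: T] x -> (0 <= (EFin \o f) x)%E by rewrite lee_fin.
pose h := nnsfun_approx measurableT mef.
have hf n x : h n x <= f x.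
  by have := le_approx n ef0 (I : setT x); rewrite -nnsfun_approxE lee_fin.
have cvgh x : h n x @[n --> \oo] --> f x.
  by have /fine_cvg := cvg_nnsfun_approx measurableT mef ef0 (I : setT x).
pose u n : T -> R := h n \* \1_(F n).
have Wu n : W (u n).
  rewrite [u n](_ : _ = \sum_(y <- finmap.enum_fset (fset_set (range (h n))))
      y *: (\1_((h n @^-1` [set y]) `&` F n) : T -> R)).
    apply: rat_closure_sum => [|y]; first exact: L2_cap_indic.
    apply: (rat_closureZ L2_cap_indic); apply: rat_closure_indic.
    exact: measurable_sfunP.
  apply/funext => x; rewrite /u /= fimfunE fsbig_finite//= fct_sumE mulr_suml.
  by apply: eq_bigr => y _; rewrite !fctE !indicE in_setI -mulnb natrM -mulrA.
apply: (rat_closure_lim L2_cap_indic (u := u)) => //.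
apply: l2norm_dominated => // [n|n x|x].
- by have [/L2_measurable] := Wu n.
- rewrite /u/= indicE !ger0_norm ?mulr_ge0//.
  by case: (x \in F n); rewrite ?mulr1// mulr0.
- have [i _ Fi] : (\bigcup_i F i) x by rewrite -coverF.
  apply: cvg_trans (cvgh x); apply: near_eq_cvg.
  exists i => // n /= /ndF/subsetPset Fin.
  by rewrite /u/= indicE mem_set ?mulr1//; exact: Fin.
Qed.

Lemma rat_closure_L2 f : L2 mu f -> W f.
Proof.
move=> Lf; have mf := L2_measurable Lf.
have Wp (g : T -> R) : measurable_fun [set: T] g ->
    (forall x, `|g x| <= `|f x|) -> W (pos_part g).
  move=> mg gf; apply: rat_closure_ge0; last by move=> x; rewrite le_max lexx orbT.
  apply: (L2_le _ _ Lf).1; first exact: measurable_maxr.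
  move=> x; apply: le_trans (gf x); rewrite ger0_norm ?le_max ?lexx ?orbT//.
  by rewrite ge_max ler_norm normr_ge0.
rewrite [f](_ : _ = pos_part f - pos_part (- f)).
  apply: (rat_closureB L2_cap_indic); apply: Wp => //.
    exact: measurableT_comp.
  by move=> x; rewrite fctE normrN.
apply/funext => x; rewrite !fctE /pos_part !maxEle.
by case: ifP; case: ifP => *; lra.
Qed.

End L2_separable.

Lemma L2_separable d (T : measurableType d) (R : realType)
    (mu : {sigma_finite_measure set T -> \bar R}) (B : nat -> set T) :
  (forall n, measurable (B n)) -> (forall A, measurable A -> <<s range B >> A) ->
  exists c : nat -> T -> R, (forall j, L2 mu (c j)) /\
    forall f, L2 mu f -> forall e : R, 0 < e -> exists j, l2norm mu (f - c j) < e.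
Proof.
move=> mB genB.
have /sigma_finiteP[F [coverF ndF mF]] := sigma_finiteT mu.
pose c j := rat_comb (cap_indic R B F) (decode [::] j).
exists c; split=> [j|f Lf e e0]; first by apply: L2_rat_comb => k; exact: L2_cap_indic.
have [_ /(_ e e0)[s fs]] := rat_closure_L2 mB genB coverF ndF mF Lf.
by have [j js] := decode_surj [::] s; exists j; rewrite /c js.
Qed.

(** * A countable family that carries the form and the sigma-algebra *)

Section core.
Context d (T : measurableType d) (R : realType).
Variables (mu : {measure set T -> \bar R}).
Variables (D : set (T -> R)) (eps : (T -> R) -> (T -> R) -> R).
Hypothesis heps : semi_dirichlet_form mu D eps.
Variable c : nat -> T -> R.
Hypothesis L2c : forall j, L2 mu (c j).
Hypothesis densec : forall f, L2 mu f -> forall e : R, 0 < e ->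
  exists j, l2norm mu (f - c j) < e.

Notation fnorm := (form1_norm mu eps).
Let hD := form1_semi_inner heps.
Let h2 := L2_semi_inner mu.

Let near_c (t : nat * nat * nat) : set (T -> R) :=
  [set v | [/\ bounded_dom D v, fnorm v <= t.1.1%:R &
               l2norm mu (v - c t.1.2) < t.2.+1%:R^-1]].

Let core (n : nat) : T -> R := xget 0 (near_c (decode (0, 0, 0)%N n)).

Lemma bounded_dom0 : bounded_dom D 0.
Proof. by split; [exact: (si_dom0 hD)|exists 0 => x; rewrite normr0]. Qed.

Let bounded_core n : bounded_dom D (core n).
Proof. by rewrite /core; case: xgetP => [v _ []//|_]; exact: bounded_dom0. Qed.

Let core_near v (N : nat) (e : R) : bounded_dom D v -> fnorm v <= N%:R -> 0 < e ->
  exists n, fnorm (core n) <= N%:R /\ l2norm mu (v - core n) < e.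
Proof.
move=> bv vN e0; have Lv : L2 mu v by case: bv => /(dom_L2 heps).
have [l] : exists l : nat, l.+1%:R^-1 < e / 2.
  have e20 : 0 < e / 2 by rewrite divr_gt0.
  by have [k] := ltr_add_invr e20; rewrite add0r; exists k.
move=> le; have l0 : 0 < l.+1%:R^-1 :> R by rewrite invr_gt0.
have [j vj] := densec Lv l0.
have [n nE] := decode_surj (0, 0, 0)%N (N, j, l).
exists n; rewrite /core nE; case: xgetP => [w _ [bw wN wj]|/(_ v)[]]; last by [].
have Lw : L2 mu w by case: bw => /(dom_L2 heps).
split=> //; apply: le_lt_trans (qnorm_triangle h2 Lv (L2c j) Lw) _.
rewrite [e]splitr ltrD//; first exact: lt_trans le.
by rewrite (qnorm_distC h2)//; exact: lt_trans le.
Qed.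

(** Separability of D for the form norm, obtained from that of L2: a countable
    subset of a form-bounded set that is dense for the L2 norm has, by
    [form1_closure_bounded], midpoint combinations that are dense for the form
    norm. *)
Lemma countable_core : exists u : nat -> T -> R,
  [/\ forall n, bounded_dom D (u n),
      forall W : set (T -> R), W `<=` D -> midpoint_closed W ->
        (forall n, W (u n)) -> form1_dense mu D eps W &
      forall f, L2 mu f -> forall e : R, 0 < e -> exists n, l2norm mu (f - u n) < e].
Proof.
exists core; split=> [|W WD Wmid Wcore|f Lf e e0]; first exact: bounded_core.
- split=> // v Dv e e0; have e20 : 0 < e / 2 by rewrite divr_gt0.
  have [v' bv' vv'] := (bounded_dom_dense heps).2 v Dv _ e20.
  have [Dv' _] := bv'.
  pose N := (Num.truncn (fnorm v')).+1.
  have v'N : fnorm v' <= N%:R by exact/ltW/truncnS_gt.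
  have /choice[n nP] : forall k : nat, exists n, fnorm (core n) <= N%:R /\
      l2norm mu (v' - core n) < k.+1%:R^-1.
    by move=> k; apply: core_near => //; rewrite invr_gt0.
  have Lv' := dom_L2 heps Dv'.
  have Lcore k : L2 mu (core (n k)) by apply: (dom_L2 heps); case: (bounded_core (n k)).
  have [] := @form1_closure_bounded _ _ _ _ _ _ heps W (fun k => core (n k)) v' N%:R => //.
  + by move=> k; case: (nP k).
  + apply/cvgrPdist_lt => r r0; have [K] := ltr_add_invr r0; rewrite add0r => Kr.
    exists K => // k /= Kk; rewrite sub0r normrN ger0_norm ?qnorm_ge0//.
    rewrite (qnorm_distC h2)//; apply: lt_le_trans (nP k).2 _; apply: le_trans (ltW Kr).
    by rewrite lef_pV2 ?posrE// ler_nat.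
  move=> _ /(_ _ e20)[w Ww v'w]; exists w => //; have Dw := WD _ Ww.
  apply: le_lt_trans (qnorm_triangle hD Dv Dv' Dw) _.
  by rewrite [e]splitr ltrD.
- have e20 : 0 < e / 2 by rewrite divr_gt0.
  have e40 : 0 < e / 4 by rewrite divr_gt0.
  have [v Dv] := sdf_dense heps Lf e40.
  have Lv := dom_L2 heps Dv.
  rewrite (Lnorm2E (si_domB h2 Lf Lv)) lte_fin => fv.
  have [v' bv' vv'] := (bounded_dom_dense heps).2 v Dv _ e40.
  have [Dv' _] := bv'; have Lv' := dom_L2 heps Dv'.
  have v'N : fnorm v' <= (Num.truncn (fnorm v')).+1%:R by exact/ltW/truncnS_gt.
  have [n [_ v'n]] := core_near bv' v'N e20.
  have Ln : L2 mu (core n) by apply: (dom_L2 heps); case: (bounded_core n).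
  exists n; apply: le_lt_trans (qnorm_triangle h2 Lf Lv Ln) _.
  have := qnorm_triangle h2 Lv Lv' Ln.
  have : l2norm mu (v - v') < e / 4.
    apply: le_lt_trans vv'; apply: (l2norm_le_form1_norm heps).
    exact: (si_domB hD).
  move: fv v'n; move: (l2norm mu (f - v)) (l2norm mu (v - v')) => a b.
  by move: (l2norm mu (v - core n)) (l2norm mu (v' - core n)) => *; lra.
Qed.

End core.

Section approx_measurable.
Context d d' (T : measurableType d) (X : measurableType d') (R : realType).
Variables (mu : {sigma_finite_measure set T -> \bar R}).
Variables (u : nat -> T -> R) (U : T -> X) (phi : nat -> X -> R).
Hypothesis L2u : forall n, L2 mu (u n).
Hypothesis denseu : forall f, L2 mu f -> forall e : R, 0 < e ->
  exists n, l2norm mu (f - u n) < e.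
Hypothesis mphi : forall n, measurable_fun [set: X] (phi n).
Hypothesis phiU : forall n x, phi n (U x) = u n x.

Let h2 := L2_semi_inner mu.

(* Markov's inequality for [f ^+ 2] at the threshold [1 / 4]. *)
Let markov2 (f : T -> R) (r : R) : L2 mu f -> 0 <= r ->
  l2norm mu f < Num.sqrt (r / 4) ->
  (mu [set x | (2^-1 <= `|f x|)%R] <= r%:E)%E.
Proof.
move=> Lf r0 fr; have mf := L2_measurable Lf.
have m2 : measurable_fun [set: T] (fun x => (f x ^+ 2)%:E).
  by apply/measurable_EFinP; exact: measurable_funX.
have := @le_integral_abse _ _ _ mu _ measurableT _ 4^-1 m2 ltac:(by []).
under eq_integral do rewrite gee0_abs ?lee_fin ?sqr_ge0//.
rewrite -(l2prodE Lf) -(sqr_qnorm h2 Lf) setTI.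
rewrite (_ : [set x | _] = [set x | 2^-1 <= `|f x|]); last first.
  apply/seteqP; split=> x /= h.
    move: h; rewrite lee_fin ger0_norm ?sqr_ge0// -(real_normK (num_real (f x))).
    move=> h; rewrite leNgt; apply/negP => h'.
    by have := normr_ge0 (f x); nra.
  rewrite lee_fin ger0_norm ?sqr_ge0// -(real_normK (num_real (f x))).
  have -> : 4^-1 = 2^-1 ^+ 2 :> R by field.
  by rewrite !expr2; apply: ler_pM => //; rewrite invr_ge0.
have fr4 : l2norm mu f ^+ 2 <= r / 4.
  rewrite -[leRHS]sqr_sqrtr ?divr_ge0// ler_pXn2r ?nnegrE ?qnorm_ge0 ?sqrtr_ge0//.
  exact: ltW.
move=> h; have : ((4^-1)%:E * mu [set x | (2^-1 <= `|f x|)%R] <= (r / 4)%:E)%E.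
  by apply: le_trans h _; rewrite lee_fin.
by rewrite [(r / 4)%R]mulrC EFinM lee_pmul2l// lte_fin.
Qed.

Let approx_measurable_fin A : measurable A -> (mu A < +oo)%E ->
  exists2 G : set X, measurable G & {ae mu, forall x, A x <-> G (U x)}.
Proof.
move=> mA muA; have LA := L2_indic mA muA.
(* The sets where [u (n k)] misses the indicator function of [A] by at least
   [1 / 2] have summable measures, so almost every point lies in finitely many
   of them, and then [A] is recognised by [1 / 2 < u (n k)] for large [k]. *)
pose r (k : nat) : R := 1 / (2 ^ k.+1)%:R.
have r0 k : 0 < r k by rewrite divr_gt0// ltr0n expn_gt0.
have /choice[n nP] : forall k, exists n, l2norm mu (\1_A - u n) < Num.sqrt (r k / 4).
  by move=> k; apply: denseu => //; rewrite sqrtr_gt0 divr_gt0.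
pose F k := [set x | 2^-1 <= `|(\1_A - u (n k)) x|].
have LF k : L2 mu (\1_A - u (n k)) by exact: (si_domB h2).
have mF k : measurable (F k).
  have mAu : measurable_fun [set: T] (fun x => `|(\1_A - u (n k)) x|).
    by apply: measurableT_comp => //; exact: L2_measurable (LF k).
  by rewrite -[F k]setTI; apply: measurable_fun_le.
have F0 : mu (lim_sup_set F) = 0%E.
  apply: lim_sup_set_cvg0 => //.
  apply: (@le_lt_trans _ _ 1%:E); last exact: ltry.
  have := @epsilon_trick R (fun=> 0%E) 1 xpredT ltac:(by []) ler01.
  rewrite [X in (_ <= X + _)%E]eseries0// add0e.
  apply: le_trans; apply: lee_nneseries => // k _.
  by rewrite add0e; exact: (markov2 (LF k) (ltW (r0 k)) (nP k)).
exists (\bigcup_K \bigcap_(k in [set k | (K <= k)%N]) [set y | 2^-1 < phi (n k) y]).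
  apply: bigcupT_measurable => K; apply: bigcap_measurableType => k _.
  rewrite [X in measurable X](_ : _ = [set: X] `&` phi (n k) @^-1` `]2^-1, +oo[).
    exact: mphi.
  by rewrite setTI; apply/seteqP; split=> y; rewrite /= in_itv/= andbT.
exists (lim_sup_set F); split => //.
  by apply: bigcapT_measurable => K; apply: bigcup_measurable.
move=> x /=; apply: contra_notP => xF.
have [K hK] : exists K, forall k, (K <= k)%N -> `|\1_A x - u (n k) x| < 2^-1.
  move: xF; rewrite /lim_sup_set => /existsNP[K /not_implyP[_ hK]].
  exists K => k Kk; rewrite ltNge; apply/negP => h; apply: hK.
  by exists k.
split=> [Ax|[K' _ hK']].
  exists K => // k /= Kk; rewrite phiU; have := hK k Kk.
  by rewrite indicE mem_set//= ltr_norml => /andP[h1 h3]; lra.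
apply: contrapT => nAx; have := hK _ (leq_maxl K K').
have := hK' _ (leq_maxr K K'); rewrite /= phiU indicE memNset//= ltr_norml.
by rewrite sub0r ltrN2 => h /andP[/(lt_trans h)]; rewrite ltxx.
Qed.

(** The [u n] generate the whole sigma-algebra up to null sets: the indicator
    function of a set of finite measure is the almost everywhere limit of some
    of them. *)
Lemma approx_measurable A : measurable A ->
  exists2 G : set X, measurable G & {ae mu, forall x, A x <-> G (U x)}.
Proof.
move=> mA; have [F coverF mF] := sigma_finiteT mu.
have /choice[G GP] : forall n, exists G : set X, measurable G /\
    {ae mu, forall x, (A `&` F n) x <-> G (U x)}.
  move=> n; have [mFn Fn] := mF n.
  have [||G mG GU] := @approx_measurable_fin (A `&` F n).
  - exact: measurableI.
  - apply: le_lt_trans Fn; apply: le_measure; rewrite ?inE//.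
    exact: measurableI.
  - by exists G.
exists (\bigcup_n G n); first by apply: bigcupT_measurable => n; case: (GP n).
have : {ae mu, forall x n, (A `&` F n) x <-> G n (U x)}.
  by apply/ae_foralln => n; case: (GP n).
apply: filterS => x hx; split=> [Ax|[n _ Gx]].
  have [n _ Fx] : (\bigcup_i F i) x by rewrite -coverF.
  by exists n => //; apply/(hx n).
by have [] := (hx n).2 Gx.
Qed.

End approx_measurable.

(** * Measurable images under an almost invertible map *)

Section left_inverse.
Context (R : realType) d' (X : measurableType d') (P : metricType R) (p0 : P).
Hypothesis completeP : complete_separable P.
Variable a : nat -> P.
Variable G : nat -> nat -> set X.
Hypothesis mG : forall n k, measurable (G n k).

Let inv (k : nat) : R := k.+1%:R^-1.

Let inv_gt0 k : 0 < inv k. Proof. by rewrite invr_gt0. Qed.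

Let le_inv (x y : R) (c : R) : 0 <= c -> (forall k, x <= y + c * inv k) -> x <= y.
Proof.
move=> c0 h; apply/ler_addgt0Pl => e e0.
have ec0 : 0 < e / (c + 1) by rewrite divr_gt0// ltr_wpDl.
have [k] := ltr_add_invr ec0; rewrite add0r -/(inv k) => ke.
apply: le_trans (h k) _; rewrite addrC lerD2r.
apply: (@le_trans _ _ ((c + 1) * inv k)).
  by apply: ler_wpM2r; [exact: ltW|rewrite lerDl].
by rewrite mulrC -ler_pdivlMr ?ltr_wpDl// ltW.
Qed.

Let dom : set X := [set y | (forall k, exists n, G n k y) /\
  forall n k m l, G n k y -> G m l y -> mdist (a n) (a m) <= inv k + inv l].

Let measurable_dom : measurable dom.
Proof.
rewrite (_ : dom = (\bigcap_k \bigcup_n G n k) `&`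
  \bigcap_n \bigcap_k \bigcap_m \bigcap_l
    (if mdist (a n) (a m) <= inv k + inv l then setT else ~` (G n k `&` G m l))).
  apply: measurableI.
    by apply: bigcapT_measurable => k; apply: bigcupT_measurable.
  do 4 apply: bigcapT_measurable => ?.
  by case: ifP => _ //; apply: measurableC; exact: measurableI.
apply/seteqP; split=> y /=.
- move=> [h1 h2]; split; first by move=> k _; have [n] := h1 k; exists n.
  move=> n _ k _ m _ l _; case: ifPn => // nle [Gn Gm].
  by move/negP: nle; apply; exact: h2.
- move=> [h1 h2]; split; first by move=> k; have [n _] := h1 k I; exists n.
  move=> n k m l Gn Gm; have := h2 n I k I m I l I; case: ifPn => // _ h.
  by exfalso; apply: h; split.
Qed.

(** The balls [G n k] that contain a point of [dom] have arbitrarily small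
    radii and pairwise compatible centres, so they shrink to a point of the
    complete space. *)
Let theta_exists y : dom y ->
  exists p, forall n k, G n k y -> mdist (a n) p <= inv k.
Proof.
move=> [/choice[n nG] comp].
have cauchy_an : cauchy ((fun k => a (n k)) @ \oo).
  apply: cauchy_exP => e e0; have e20 : 0 < e / 2 by rewrite divr_gt0.
  have [k] := ltr_add_invr e20; rewrite add0r -/(inv k) => ke.
  exists (a (n k)); exists k => // l /= kl; rewrite ballEmdist/=.
  apply: le_lt_trans (comp _ _ _ _ (nG k) (nG l)) _; rewrite [e]splitr ltrD//.
  by apply: le_lt_trans ke; rewrite lef_pV2 ?posrE// ler_nat.
have [p ap] := completeP.2 _ _ cauchy_an.
exists p => m k Gm; apply: (@le_inv _ _ 2) => // l.
have [K _ hK] : \forall l' \near \oo, mdist p (a (n l')) < inv l.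
  exact: (@metricType_numDomainType.cvgr_dist_lt _ _ _ _ _ _ _ ap _ (inv_gt0 l)).
have := hK _ (leq_maxl K l); rewrite /= => pa.
have := metric_triangle (a m) (a (n (maxn K l))) p.
have := comp _ _ _ _ Gm (nG (maxn K l)).
have : inv (maxn K l) <= inv l by rewrite lef_pV2 ?posrE// ler_nat ltnS leq_maxr.
rewrite [mdist (a (n _)) p]metric_sym; move: pa.
move: (mdist p _) (mdist (a m) _) (mdist (a m) p) (inv k) (inv l) (inv _) => *; lra.
Qed.

(** If the balls around the points [a n] are encoded by measurable sets [G n k]
    of [X], then the points of [P] can be measurably recovered from their
    codes; this replaces the Lusin-Souslin theorem on injective images. *)
Lemma measurable_decoding : dense_seq a ->
  exists (Y : set X) (theta : X -> P),
  [/\ measurable Y,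
      forall B, <<s @open P >> B -> measurable (Y `&` theta @^-1` B) &
      forall y p, (forall n k, G n k y <-> ball (a n) k.+1%:R^-1 p) ->
        Y y /\ theta y = p].
Proof.
move=> ha.
have /choice[theta thetaP] : forall y, exists p,
    dom y -> forall n k, G n k y -> mdist (a n) p <= inv k.
  move=> y; have [dy|ndy] := pselect (dom y); last by exists p0.
  by have [p hp] := theta_exists dy; exists p.
have theta_closed F : closed F -> measurable (dom `&` theta @^-1` F).
  move=> cF; rewrite (_ : _ `&` _ = dom `&` \bigcap_n \bigcap_k
      if `[< exists2 p, F p & mdist (a n) p <= inv k >] then setT else ~` G n k).
    apply: measurableI; first exact: measurable_dom.
    do 2 apply: bigcapT_measurable => ?.
    by case: ifP => _ //; exact: measurableC.
  apply/seteqP; split=> y /= [dy h]; split=> //.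
    move=> n _ k _; case: ifPn => // /asboolPn nF Gn; apply: nF.
    by exists (theta y) => //; exact: thetaP.
  apply: cF => B /nbhs_ballP[e /= e0 eB].
  have e20 : 0 < e / 2 by rewrite divr_gt0.
  have [k] := ltr_add_invr e20; rewrite add0r -/(inv k) => ke.
  have [n Gn] := dy.1 k; have := h n I k I; case: ifPn => // /asboolP[p Fp ap] _.
  exists p; split=> //; apply: eB; rewrite ballEmdist/=.
  apply: le_lt_trans (metric_triangle _ (a n) _) _.
  rewrite metric_sym [e]splitr ltrD//; apply: le_lt_trans ke => //.
  exact: thetaP.
have theta_borel B : <<s @open P >> B -> measurable (dom `&` theta @^-1` B).
  have domD A : dom `&` theta @^-1` (~` A) = dom `\` (dom `&` theta @^-1` A).
    apply/seteqP; split=> y /= [dy nA]; first by split=> // -[].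
    by split=> // ?; apply: nA.
  move: B; apply: (@smallest_sub _ _ _ [set B | measurable (dom `&` theta @^-1` B)]).
    split=> /= [|A mA|A mA].
    - by rewrite preimage_set0 setI0.
    - by rewrite setTD domD; exact: measurableD.
    - by rewrite preimage_bigcup setI_bigcupr; exact: bigcupT_measurable.
  move=> B oB /=; rewrite -[B]setCK domD; apply: measurableD => //.
  by apply: theta_closed; exact: open_closedC.
exists dom, theta; split=> // y p Gp.
have dy : dom y.
  split=> [k|n k m l /Gp + /Gp].
    by have [n] := ha p _ (inv_gt0 k); exists n; exact/Gp.
  rewrite !ballEmdist/= => h1 h3; apply: le_trans (metric_triangle _ p _) _.
  by rewrite lerD ?(ltW h1)// metric_sym ltW.
split=> //; apply/mdist_positivity/eqP; rewrite eq_le mdist_ge0 andbT.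
apply: (@le_inv _ _ 2) => // k; rewrite add0r.
have [n an] := ha p _ (inv_gt0 k); have := thetaP y dy n k ((Gp n k).2 an).
move: an; rewrite ballEmdist/=; have := metric_triangle (theta y) (a n) p.
rewrite [mdist (theta y) (a n)]metric_sym -/(inv k).
by move: (mdist _ _) (mdist _ _) (mdist _ _) (inv k) => *; lra.
Qed.

End left_inverse.

Section measurable_image.
Context (R : realType) d d' (E : measurableType d) (X : measurableType d').
Variables (mu : {measure set E -> \bar R}).
Variables (O : nat -> set X) (U : E -> X).
Hypothesis mO : forall n, measurable (O n).
Hypothesis sepO : forall x y, (forall n, O n x <-> O n y) -> x = y.
Hypothesis mU : measurable_fun [set: E] U.
Hypothesis approxU : forall A, measurable A ->
  exists2 G : set X, measurable G & {ae mu, forall x, A x <-> G (U x)}.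

(** A measurable map that generates the sigma-algebra up to null sets has a
    measurable left inverse off a null set, by [measurable_decoding]; the image
    of [A] then consists of the points that are decoded into [A] and are fixed
    by decoding followed by [U], which are measurable conditions. *)
Lemma measurable_image_off_null : lusin_measurable_space R E ->
  exists N : set E, [/\ measurable N, mu N = 0%E,
    forall x y, ~ N x -> ~ N y -> U x = U y -> x = y &
    forall A, measurable A -> A `<=` ~` N -> measurable (U @` A)].
Proof.
move=> /lusin_inverse[P [f [g [completeP [fK gK] mf mg]]]].
have [a ha] := separable_dense_seq (g point) completeP.1.
have mball n k : measurable (g @^-1` ball (a n) k.+1%:R^-1).
  by apply: mg; apply: sub_sigma_algebra; exact: metric_open_ball.
have /choice[G GP] : forall nk : nat * nat, exists G : set X, measurable G /\
    {ae mu, forall x, (g @^-1` ball (a nk.1) nk.2.+1%:R^-1) x <-> G (U x)}.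
  by move=> nk; have [G] := approxU (mball nk.1 nk.2); exists G.
have : {ae mu, forall x n k, ball (a n) k.+1%:R^-1 (g x) <-> G (n, k) (U x)}.
  by apply/ae_foralln => n; apply/ae_foralln => k; case: (GP (n, k)).
move=> [N [mN N0 subN]]; exists N.
have mG n k : measurable (G (n, k)) by case: (GP (n, k)).
have [Y [theta [mY mtheta thetaP]]] :=
  measurable_decoding (g point) completeP (G := fun n k => G (n, k)) mG ha.
have thetaU x : ~ N x -> Y (U x) /\ f (theta (U x)) = x.
  move=> Nx; have /thetaP[YU tU] : forall n k, G (n, k) (U x) <-> ball (a n) k.+1%:R^-1 (g x).
    move=> n k; apply: iff_sym; move: n k; apply: contrapT => h; apply: Nx.
    exact: subN.
  by rewrite tU gK.
have mftheta A : measurable A -> measurable (Y `&` [set y | A (f (theta y))]).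
  by move=> mA; apply: (mtheta (f @^-1` A)); exact: mf.
split=> // [x y Nx Ny Uxy|A mA AN].
  by rewrite -(thetaU x Nx).2 Uxy (thetaU y Ny).2.
rewrite (_ : U @` A = (Y `&` [set y | A (f (theta y))]) `&` \bigcap_n
    ((Y `&` [set y | (U @^-1` O n) (f (theta y))] `&` O n) `|`
     (Y `&` [set y | (U @^-1` ~` O n) (f (theta y))] `&` ~` O n))).
  apply: measurableI; first exact: mftheta.
  apply: bigcapT_measurable => n.
  have mUO : measurable (U @^-1` O n) by rewrite -[U @^-1` _]setTI; exact: mU.
  apply: measurableU; apply: measurableI => //; last exact: measurableC.
    exact: mftheta.
  by apply: mftheta; rewrite preimage_setC; exact: measurableC.
apply/seteqP; split=> [_ [x Ax <-]|y [[Yy Ay] hy]].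
  have [YU tU] := thetaU x (AN _ Ax); split; first by rewrite /= tU.
  move=> n _; have [OU|OU] := pselect (O n (U x)); [left|right].
    by split=> //; split; rewrite //= tU.
  by split=> //; split; rewrite //= tU.
exists (f (theta y)) => //; apply: sepO => n.
by have [[[_ /= ?] ?]|[[_ /= ?] ?]] := hy n I; split.
Qed.

End measurable_image.

(** * Countable products of Polish metric spaces *)

Section metric_prod.
Context (R : realType) (T : nat -> metricType R).

Definition metric_prod : Type := forall n, T n.

HB.instance Definition _ := gen_eqMixin metric_prod.
HB.instance Definition _ := gen_choiceMixin metric_prod.

Let inv (k : nat) : R := k.+1%:R^-1.

Let inv_gt0 k : 0 < inv k. Proof. by rewrite invr_gt0. Qed.

Let inv_le n m : (n <= m)%N -> inv m <= inv n.
Proof. by move=> nm; rewrite lef_pV2 ?posrE// ler_nat ltnS. Qed.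

Let small_inv (e : R) : 0 < e -> exists N, forall n, (N <= n)%N -> inv n < e.
Proof.
move=> e0; have [N] := ltr_add_invr e0; rewrite add0r => Ne; exists N => n Nn.
exact: le_lt_trans (inv_le Nn) Ne.
Qed.

(** Capping the [n]-th distance at [1 / (n + 1)] makes all but finitely many
    coordinates irrelevant at any given scale. *)
Definition capped_dist (x y : metric_prod) (n : nat) : R :=
  Num.min (mdist (x n) (y n)) n.+1%:R^-1.

Definition prod_dist (x y : metric_prod) : R := sup (range (capped_dist x y)).

Let capped_ge0 x y n : 0 <= capped_dist x y n.
Proof. by rewrite le_min mdist_ge0 ltW. Qed.

Let has_sup_capped x y : has_sup (range (capped_dist x y)).
Proof.
split; first by exists (capped_dist x y 0%N), 0%N.
exists 1 => _ [n _ <-]; rewrite ge_min; apply/orP; right.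
by rewrite invf_le1// ler1n.
Qed.

Lemma capped_le x y n : capped_dist x y n <= prod_dist x y.
Proof. by apply: ub_le_sup; [exact: (has_sup_capped x y).2|exists n]. Qed.

Lemma prod_dist_le x y (r : R) :
  (forall n, capped_dist x y n <= r) -> prod_dist x y <= r.
Proof.
move=> h; apply: (ge_sup (has_sup_capped x y).1).
by move=> _ [n _ <-].
Qed.

Lemma prod_distxx x : prod_dist x x = 0.
Proof.
apply/eqP; rewrite eq_le (le_trans _ (capped_le x x 0%N))// andbT.
by apply: prod_dist_le => n; rewrite /capped_dist mdistxx ge_min lexx.
Qed.

Lemma prod_dist_positivity x y : prod_dist x y = 0 -> x = y.
Proof.
move=> xy; apply: functional_extensionality_dep => n.
have := capped_le x y n; rewrite xy ge_min leNgt; case/orP => [|h].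
  rewrite -leNgt => h; apply: mdist_positivity.
  by apply/eqP; rewrite eq_le h mdist_ge0.
by have := lt_le_trans (inv_gt0 n) h; rewrite ltxx.
Qed.

Lemma prod_dist_sym x y : prod_dist x y = prod_dist y x.
Proof.
rewrite /prod_dist (_ : capped_dist x y = capped_dist y x)//; apply/funext => n.
by rewrite /capped_dist metric_sym.
Qed.

Lemma prod_dist_triangle y x z : prod_dist x z <= prod_dist x y + prod_dist y z.
Proof.
apply: (@prod_dist_le) => n.
apply: le_trans (lerD (capped_le x y n) (capped_le y z n)).
have := metric_triangle (x n) (y n) (z n); have := inv_gt0 n.
rewrite /capped_dist /inv.
have := mdist_ge0 (x n) (y n); have := mdist_ge0 (y n) (z n).
move: (mdist (x n) (y n)) (mdist (y n) (z n)) (mdist (x n) (z n)) (_^-1) => a b c w *.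
by rewrite !minEle; case: ifP => ?; case: ifP => ?; case: ifP => ?; lra.
Qed.

HB.instance Definition _ := isMetric.Build R metric_prod
  prod_distxx prod_dist_positivity prod_dist_sym prod_dist_triangle.

Lemma prod_ballP (x y : metric_prod) (r : R) : 0 < r ->
  ball x r y <-> forall n, capped_dist x y n < r.
Proof.
move=> r0; rewrite ballEmdist/=; split=> [xy n|h].
  exact: le_lt_trans (capped_le x y n) xy.
have [N hN] := small_inv r0.
have [b [br hb]] : exists b, b < r /\ forall n, (n < N)%N -> capped_dist x y n <= b.
  elim: N {hN} => [|N [b [br hb]]]; first by exists 0.
  exists (Num.max b (capped_dist x y N)); split; first by rewrite gt_max br h.
  move=> n; rewrite ltnS leq_eqVlt le_max => /orP[/eqP->|/hb ->//].
  by rewrite lexx orbT.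
apply: (@le_lt_trans _ _ (Num.max b (inv N))); last by rewrite gt_max br hN.
apply: prod_dist_le => n; rewrite le_max; have [/hb ->//|Nn] := ltnP n N.
by apply/orP; right; rewrite ge_min; apply/orP; right; exact: inv_le.
Qed.

Lemma prod_ball_coord (x y : metric_prod) n (r : R) : 0 < r ->
  ball x (Num.min r n.+1%:R^-1) y -> ball (x n) r (y n).
Proof.
move=> r0; rewrite ballEmdist/= => /(le_lt_trans (capped_le x y n)).
rewrite /capped_dist ballEmdist/= lt_min !gt_min ltxx orbF.
by move=> /andP[/orP[//|wr] dw]; exact: lt_trans wr.
Qed.

Lemma metric_prod_coord_continuous n : continuous (fun x : metric_prod => x n).
Proof.
move=> x B /nbhs_ballP[e /= e0 eB]; apply/nbhs_ballP.
exists (Num.min e n.+1%:R^-1); first by rewrite /= lt_min e0 inv_gt0.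
by move=> y /prod_ball_coord xy; apply: eB; exact: xy.
Qed.

Lemma metric_prod_finite_ball (F : set_system metric_prod) {FF : Filter F}
    (x : metric_prod) (r : R) : 0 < r ->
  (forall n (e : R), 0 < e -> F [set y | ball (x n) e (y n)]) -> F (ball x r).
Proof.
move=> r0 hF; have [N hN] := small_inv r0.
have : F [set y | forall n, (n < N)%N -> ball (x n) r (y n)].
  elim: N {hN} => [|N IH]; first by apply: filterS filterT => y _ n.
  apply: filterS (filterI IH (hF N r r0)) => y [h hNy] n.
  by rewrite ltnS leq_eqVlt => /orP[/eqP->|/h].
apply: filterS => y hy; apply/(prod_ballP _ _ r0) => n.
rewrite /capped_dist gt_min; have [/hy|/hN h] := ltnP n N.
  by rewrite ballEmdist/= => ->.
by apply/orP; right.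
Qed.

(** The metric topology is coarser than the topology of pointwise
    convergence, so that Tychonoff's theorem applies. *)
Lemma metric_prod_compact (A : forall n, set (T n)) :
  (forall n, compact (A n)) ->
  compact [set x : metric_prod | forall n, A n (x n)].
Proof.
move=> cA; pose j (x : prod_topology T) : metric_prod := x.
have cj : continuous j.
  move=> x B /nbhs_ballP[e /= e0 eB].
  apply: (@filterS _ (nbhs (x : prod_topology T)) _ (j @^-1` ball (j x) e)).
    by move=> y; exact: eB.
  apply: (@metric_prod_finite_ball (j @ nbhs (x : prod_topology T)) _ (j x) e e0).
  move=> n r r0; have := @proj_continuous _ T n x (ball (x n) r).
  by apply; exact: nbhsx_ballx.
rewrite (_ : [set x | _] = j @` [set x | forall n, A n (x n)]); last first.
  by apply/seteqP; split=> [x Ax|_ [x Ax <-]] //; exists x.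
apply: (@continuous_compact (prod_topology T) metric_prod j).
  exact: continuous_subspaceT.
exact: tychonoff.
Qed.

Section dense.
Variable a : forall n, nat -> T n.
Hypothesis ha : forall n, dense_seq (a n).

(** Finite lists of indices, completed by the index 0, suffice because a ball
    only constrains finitely many coordinates; they keep the family
    countable. *)
Definition prod_seq (m : nat) : metric_prod :=
  let s := decode [::] m in fun n => a n (nth 0%N s n).

Lemma dense_prod_seq : dense_seq prod_seq.
Proof.
move=> x e e0; have [N hN] := small_inv e0.
have /choice[k hk] : forall n, exists k, ball (a n k) e (x n).
  by move=> n; exact: ha.
have [m hm] := decode_surj [::] (mkseq k N); exists m.
apply/(prod_ballP _ _ e0) => n; rewrite /capped_dist gt_min.
have [nN|/hN h] := ltnP n N; last by apply/orP; right.
by rewrite /prod_seq hm nth_mkseq//; have := hk n; rewrite ballEmdist/= => ->.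
Qed.

Lemma measurable_preimage_prod d (X : measurableType d) (h : X -> metric_prod) :
  (forall n B, <<s @open (T n) >> B -> measurable ((fun x => h x n) @^-1` B)) ->
  forall B, <<s @open metric_prod >> B -> measurable (h @^-1` B).
Proof.
move=> mh; apply: (measurable_preimage_balls dense_prod_seq) => m k.
set r := k.+1%:R^-1; have r0 : 0 < r := inv_gt0 k.
rewrite (_ : h @^-1` _ = \bigcap_n (if inv n < r then setT else
    (fun x => h x n) @^-1` ball (prod_seq m n) r)).
  apply: bigcapT_measurable => n; case: ifP => _ //; apply: mh.
  by apply: sub_sigma_algebra; exact: metric_open_ball.
apply/seteqP; split=> x.
  move=> /(prod_ballP _ _ r0) hx n _; case: ifPn => // nr.
  have := hx n; rewrite /capped_dist gt_min -/(inv n) (negbTE nr) orbF.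
  by rewrite /= ballEmdist.
move=> hx; apply/(prod_ballP _ _ r0) => n; rewrite /capped_dist gt_min -/(inv n).
apply/orP; have := hx n I; case: ifPn => [nr _|_]; first by right.
by rewrite /= ballEmdist; left.
Qed.

End dense.

Lemma metric_prod_polish : (forall n, complete_separable (T n)) ->
  metric_prod -> complete_separable metric_prod.
Proof.
move=> cT x0; split.
  have exa n : exists a, @dense_seq R (T n) a.
    by apply: (separable_dense_seq (x0 n)); case: (cT n).
  pose a n := sval (cid (exa n)).
  have ha n : dense_seq (a n) by rewrite /a; case: cid.
  exists (range (prod_seq a)).
    by apply: card_le_trans (card_image_le _ _) _; exact: countableP.
  move=> O [x Ox] oO; have /nbhs_ballP[e /= e0 eO] : nbhs x O by exact: open_nbhs_nbhs.
  have [m hm] := dense_prod_seq ha x e0.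
  by exists (prod_seq a m); split; [apply: eO; exact: ball_sym|exists m].
move=> F PF cF.
have exl n : exists l : T n, (fun x : metric_prod => x n) @ F --> l.
  apply: (cT n).2; apply: cauchy_exP => e e0.
  have r0 : 0 < Num.min e n.+1%:R^-1 by rewrite lt_min e0 inv_gt0.
  have [x Fx] := (cauchyP F).1 cF _ r0; exists (x n).
  suff : F [set y | ball (x n) e (y n)] by [].
  by apply: filterS Fx => y xy; exact: (prod_ball_coord e0 xy).
exists (fun n => sval (cid (exl n))); apply/fcvg_ballP => e e0.
apply: metric_prod_finite_ball => // n r r0.
by case: cid => l /= /(_ (ball l r)); apply; exact: nbhsx_ballx.
Qed.

End metric_prod.

(** * Transport of the form to a larger space *)

Section transport.
Context d (E : measurableType d) (R : realType) (E1 : ptopologicalType).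
Variables (mu : {measure set E -> \bar R}) (i : E -> E1).
Hypothesis inj_i : injective i.
Hypothesis mi : measurable_fun [set: E] (i : E -> borelType E1).
Hypothesis mimg : forall A, measurable A ->
  measurable (i @` A : set (borelType E1)).

Definition image_measure : {measure set (borelType E1) -> \bar R} :=
  measure_function_pushforward__canonical__measure_function_Measure mu mi.

Let mubar := image_measure.

Lemma image_measureE A : mubar A = mu (i @^-1` A). Proof. by []. Qed.

Let preimage_img A : i @^-1` (i @` A) = A.
Proof.
by apply/seteqP; split=> [x [x' Ax' /inj_i <-]|x Ax] //; exists x.
Qed.

Let preimage_compl : i @^-1` (~` range i) = set0.
Proof. by rewrite -subset0 => x; apply; exists x. Qed.

Lemma image_measure_extension : extension_by_zero i mu mubar.
Proof.
split=> [A mA|]; rewrite image_measureE ?preimage_img//.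
by rewrite preimage_compl measure0.
Qed.

Lemma measurable_trace A : measurable A <->
  exists2 B : set (borelType E1), measurable B & A = i @^-1` B.
Proof.
split=> [mA|[B mB ->]]; last by rewrite -[X in measurable X]setTI; exact: mi.
by exists (i @` A); [exact: mimg|rewrite preimage_img].
Qed.

Lemma ae_image (Q : E1 -> Prop) :
  {ae mubar, forall y, Q y} <-> {ae mu, forall x, Q (i x)}.
Proof.
split=> [[N [mN N0 QN]]|[N [mN N0 QN]]].
  exists (i @^-1` N); split; last by move=> x nQ; apply: QN.
    by apply/measurable_trace; exists N.
  by rewrite -image_measureE.
have mr : measurable (range i : set (borelType E1)) by exact: mimg.
exists (i @` N `|` ~` range i); split.
- by apply: measurableU; [exact: mimg|exact: measurableC].
- by rewrite image_measureE preimage_setU preimage_img preimage_compl setU0.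
- move=> y nQ; have [[x _ ixy]|ny] := pselect (range i y); [left|by right].
  by exists x => //; apply: QN => /=; rewrite ixy.
Qed.

Definition zero_ext (u : E -> R) : borelType E1 -> R := fun y =>
  if pselect (exists x, i x = y) is left h then u (sval (cid h)) else 0.

Lemma zero_extK u : zero_ext u \o i = u.
Proof.
apply/funext => x; rewrite /zero_ext /=; case: pselect => [h|[]]; last by exists x.
by case: cid => x' /= /inj_i ->.
Qed.

Lemma measurable_zero_ext u : measurable_fun [set: E] u ->
  measurable_fun [set: borelType E1] (zero_ext u).
Proof.
move=> mu_ _ B mB; rewrite setTI.
rewrite (_ : _ @^-1` B = (i @` (u @^-1` B)) `|`
    (~` range i `&` (if 0 \in B then setT else set0))).
  apply: measurableU.
    by apply: mimg; rewrite -[X in measurable X]setTI; exact: mu_.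
  apply: measurableI; first by apply: measurableC; exact: mimg.
  by case: ifP => _; [exact: measurableT|exact: measurable0].
apply/seteqP; split=> [y|y [[x Bx <-]|[ny]]].
- rewrite /= {1}/zero_ext; case: pselect => [h|h] By.
    by left; case: cid By => x /= ixy Bux; exists x.
  right; rewrite mem_set//; split=> // -[x _ ixy]; apply: h.
  by exists x.
- by rewrite /= -[zero_ext u (i x)]/((zero_ext u \o i) x) zero_extK.
- rewrite /= /zero_ext; case: pselect => [[x ixy]|_].
    by exfalso; apply: ny; exists x.
  by case: ifPn => [/set_mem|].
Qed.

Lemma L2_image (v : borelType E1 -> R) : L2 mubar v <->
  measurable_fun [set: borelType E1] v /\ L2 mu (v \o i).
Proof.
have mvi : measurable_fun [set: borelType E1] v -> measurable_fun [set: E] (v \o i).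
  by move=> mv; exact: measurableT_comp mv mi.
have sq : measurable_fun [set: borelType E1] v ->
    (\int[mubar]_y (v y ^+ 2)%:E = \int[mu]_x ((v \o i) x ^+ 2)%:E)%E.
  move=> mv; rewrite [LHS](ge0_integral_pushforward mi)//.
  - by apply/measurable_EFinP; exact: measurable_funX.
  - by move=> y _; rewrite lee_fin sqr_ge0.
split=> [/L2P[mv v2]|[mv /L2P[_ v2]]].
  by split=> //; apply/L2P; split; [exact: mvi|rewrite -sq].
by apply/L2P; rewrite sq.
Qed.

Lemma l2prod_image u v : L2 mubar u -> L2 mubar v ->
  l2prod mubar u v = l2prod mu (u \o i) (v \o i).
Proof.
move=> Lu Lv; rewrite /l2prod /Rintegral; congr fine.
have [mu_ Lui] := (L2_image u).1 Lu; have [mv Lvi] := (L2_image v).1 Lv.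
rewrite [LHS](integral_pushforward mi)//.
  by apply/measurable_EFinP; exact: measurable_funM.
exact: L2_integrable_prod Lui Lvi.
Qed.

Variables (D : set (E -> R)) (eps : (E -> R) -> (E -> R) -> R).
Hypothesis heps : semi_dirichlet_form mu D eps.

Let D1 := extension_dom i mubar D.
Let eps1 := extension_form i eps.

Lemma zero_ext_dom u : D u -> D1 (zero_ext u).
Proof.
move=> Du; split; last by rewrite zero_extK.
apply/L2_image; rewrite zero_extK; split; last exact: (dom_L2 heps).
by apply: measurable_zero_ext; exact: L2_measurable (dom_L2 heps Du).
Qed.

Let D1_L2 u : D1 u -> L2 mubar u. Proof. by case. Qed.

Let D1_D u : D1 u -> D (u \o i). Proof. by case. Qed.

Lemma form1_image u v : D1 u -> D1 v ->
  form1 mubar eps1 u v = form1 mu eps (u \o i) (v \o i).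
Proof.
move=> [Lu _] [Lv _]; rewrite /form1 -!/(l2prod _ _ _).
by rewrite (l2prod_image Lu Lv).
Qed.

Lemma form1_norm_image u : D1 u ->
  form1_norm mubar eps1 u = form1_norm mu eps (u \o i).
Proof. by move=> Du; rewrite /form1_norm form1_image. Qed.

Let hD := form1_semi_inner heps.

Let D1_lin (a : R) u v : D1 u -> D1 v -> D1 (a *: u + v).
Proof.
move=> [Lu Du] [Lv Dv]; split; first exact: (L2_dom_lin a Lu Lv).
exact: (sdf_dom_lin heps a Du Dv).
Qed.

Let D1_B u v : D1 u -> D1 v -> D1 (u - v).
Proof.
move=> Du Dv; split.
  exact: (si_domB (L2_semi_inner mubar) (D1_L2 Du) (D1_L2 Dv)).
exact: (si_domB hD (D1_D Du) (D1_D Dv)).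
Qed.

Lemma semi_dirichlet_image : semi_dirichlet_form mubar D1 eps1.
Proof.
have ae_comp (u v : borelType E1 -> R) : u = v %[ae mubar] -> u \o i = v \o i %[ae mu].
  by move/(ae_image (fun y => setT y -> u y = v y)).
split.
- by move=> u [].
- move=> u v [Lu Du] mv uv; have [Lv _] := L2_ae mv uv Lu; split=> //.
  have [_ Lvi] := (L2_image v).1 Lv.
  exact: (sdf_dom_ae heps Du (L2_measurable Lvi) (ae_comp _ _ uv)).
- move=> u u' v v' [_ Du] [_ Du'] [_ Dv] [_ Dv'] uu' vv'.
  exact: (sdf_ae heps Du Du' Dv Dv' (ae_comp _ _ uu') (ae_comp _ _ vv')).
- split; first exact: (si_dom0 (L2_semi_inner mubar)).
  exact: (sdf_dom0 heps).
- exact: D1_lin.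
- move=> f Lf e e0; have [mf Lfi] := (L2_image f).1 Lf.
  have [u Du fu] := sdf_dense heps Lfi e0.
  exists (zero_ext u); first exact: zero_ext_dom.
  have L1 : L2 mubar (f - zero_ext u).
    exact: (si_domB (L2_semi_inner mubar) Lf (D1_L2 (zero_ext_dom Du))).
  rewrite (Lnorm2E L1) /qnorm l2prod_image//.
  have -> : (f - zero_ext u) \o i = f \o i - u.
    by rewrite -[in RHS](zero_extK u).
  rewrite -[Num.sqrt _]/(l2norm mu _) -Lnorm2E//.
  exact: (si_domB (L2_semi_inner mu) Lfi (dom_L2 heps Du)).
- by move=> a u v w [_ Du] [_ Dv] [_ Dw]; exact: (sdf_linl heps a Du Dv Dw).
- by move=> a u v w [_ Du] [_ Dv] [_ Dw]; exact: (sdf_linr heps a Du Dv Dw).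
- by move=> u [_ Du]; exact: (sdf_ge0 heps Du).
- move=> u_ Du_ cu; have Dui n : D (u_ n \o i) by exact: D1_D.
  have [|u Du cvu] := sdf_complete heps Dui.
    move=> e e0; have [N hN] := cu e e0; exists N => m n Nm Nn.
    by have := hN m n Nm Nn; rewrite form1_norm_image//; exact: D1_B.
  exists (zero_ext u); first exact: zero_ext_dom.
  apply: cvg_trans cvu; apply: near_eq_cvg; apply: nearW => n.
  rewrite form1_norm_image; last exact: D1_B (zero_ext_dom Du).
  by congr form1_norm; rewrite -[in LHS](zero_extK u).
- have [K K0 hK] := sdf_sector heps; exists K => // u v Du Dv.
  by rewrite form1_image// !form1_norm_image//; exact: hK (D1_D Du) (D1_D Dv).
- move=> u [Lu Du]; split; last exact: (sdf_dom_contraction heps Du).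
  apply: (L2_le _ _ Lu).1; last by move=> x; exact: norm_unit_contraction.
  have mu_ := L2_measurable Lu.
  by apply: measurable_minr; [exact: measurable_maxr|exact: measurable_cst].
- by move=> u [_ Du]; exact: (sdf_contraction heps Du).
Qed.

(** The nest is the constant sequence [F]: the complement of [F] is negligible,
    so every element of the domain vanishes outside of [F] almost everywhere,
    and all the conditions on quasi-continuity reduce to plain continuity
    on [F]. *)
Section quasi_regular.
Variables (F : set E1) (phi : nat -> E1 -> R).
Hypothesis haus : hausdorff_space E1.
Hypothesis compactF : compact F.
Hypothesis aeF : {ae mu, forall x, F (i x)}.
Hypothesis cont_phi : forall n, continuous (phi n).
Hypothesis mphi : forall n, measurable_fun [set: borelType E1] (phi n).
Hypothesis Dphi : forall n, D (phi n \o i).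
Hypothesis sepF : forall x y, F x -> F y -> (forall n, phi n x = phi n y) -> x = y.
Hypothesis dense_phi : forall W : set (E -> R), W `<=` D -> midpoint_closed W ->
  (forall n, W (phi n \o i)) -> form1_dense mu D eps W.

Let nestF : nest mubar D1 eps1 (fun=> F).
Proof.
split=> //; first by move=> _; exact: compact_closed.
split=> [u [_ _ []]//|u Du e e0]; exists u.
  exists 0%N => //; split=> //; apply/ae_image.
  by apply: filterS aeF => x Fx; case.
rewrite subrr form1_norm_image; last first.
  by split; [exact: (si_dom0 (L2_semi_inner mubar))|exact: (sdf_dom0 heps)].
rewrite [form1_norm _ _ _](_ : _ = 0)//.
rewrite /form1_norm [form1 _ _ _ _](si_0l hD) ?sqrtr0//.
exact: (sdf_dom0 heps).
Qed.

Let quasi_continuous_phi f : {within F, continuous f} ->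
  quasi_continuous mubar D1 eps1 F f.
Proof. by move=> cf; exists (fun=> F); split=> // y []. Qed.

Lemma quasi_regular_image : quasi_regular mubar D1 eps1.
Proof.
have Dphi1 n : D1 (phi n).
  by split=> //; apply/L2_image; split=> //; exact: (dom_L2 heps).
split.
- by exists (fun=> F).
- pose W := [set v | D v /\ exists2 f : E1 -> R, {within F, continuous f} &
                     v = f \o i %[ae mu]].
  have [|||_ Wdense] := dense_phi (W := W).
  + by move=> v [].
  + move=> u v [Du [f cf uf]] [Dv [g cg vg]]; split.
      by apply: (si_domD hD); exact: (si_domZ hD).
    exists (midpoint f g); last first.
      by apply: filterS2 uf vg => x /= /(_ I) ux /(_ I) vx _; rewrite /midpoint !fctE ux vx.
    move=> x; apply: cvgD; apply: cvgM; try exact: cvg_cst; [exact: cf|exact: cg].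
  + move=> n; split=> //; exists (phi n); last exact: aeW.
    exact: continuous_subspaceT.
  exists [set v | D1 v /\ W (v \o i)].
    split=> [v []//|u Du e e0]; have [v Wv uv] := Wdense _ (D1_D Du) e e0.
    have [Dv _] := Wv; exists (zero_ext v).
      by split; [exact: zero_ext_dom|rewrite zero_extK].
    rewrite form1_norm_image; last exact: D1_B (zero_ext_dom Dv).
    by have -> : (u - zero_ext v) \o i = u \o i - v by rewrite -[in RHS](zero_extK v).
  move=> v [Dv [_ [f cf vf]]]; exists F, f; split; first exact: quasi_continuous_phi.
  apply/ae_image; apply: filterS2 aeF vf => x Fx /(_ I) vx; split=> //.
- exists phi, (fun=> F), phi, (~` F); split=> //.
  + move=> n; split.
      by apply: quasi_continuous_phi; exact: continuous_subspaceT.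
    by apply/ae_image; apply: filterS aeF.
  + by exists (fun=> F) => // y Fy k _.
  + by move=> n y /contrapT.
  + move=> x y /contrapT Fx /contrapT Fy xy; apply: contrapT => /forallNP h.
    by apply: xy; apply: sepF => // n; apply: contrapT; exact: h.
Qed.

End quasi_regular.

End transport.

(** * The product of a Polish space with the space of real sequences *)

Lemma real_line_polish (R : realType) : @complete_separable R R^o.
Proof.
split; last by move=> F PF cF; exists (lim F); exact: (@cauchy_cvg R^o F PF cF).
exists (range (ratr : rat -> R^o)).
  by apply: card_le_trans (card_image_le _ _) _; exact: countableP.
move=> O [x Ox] oO; have /nbhs_ballP[e /= e0 eO] : nbhs x O by exact: open_nbhs_nbhs.
have [q] := @rat_in_itvoo R (x - e) x ltac:(by rewrite ltrBlDr ltrDl).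
rewrite in_itv/= => /andP[h1 h2]; exists (ratr q); split; last by exists q.
apply: eO; rewrite /ball/= ger0_norm; first by rewrite ltrBlDr -ltrBlDl.
by rewrite subr_ge0 ltW.
Qed.

Section pointed_at.

Definition pointed_at (M : Type) (m0 : M) : Type := M.

HB.instance Definition _ (M : topologicalType) (m0 : M) :=
  Topological.copy (pointed_at m0) M.

HB.instance Definition _ (M : topologicalType) (m0 : M) :=
  isPointed.Build (pointed_at m0) m0.

End pointed_at.

Section larger_space.
Context (R : realType) (P : metricType R) (p0 : P).
Hypothesis polishP : complete_separable P.

Definition factors (n : nat) : metricType R := if n is n'.+1 then R^o else P.

Definition mk_point (p : P) (r : nat -> R) : metric_prod factors :=
  fun n => match n return factors n with n'.+1 => r n' | 0%N => p end.

Definition larger_space : ptopologicalType := pointed_at (mk_point p0 (fun=> 0)).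

Definition coord0 (y : larger_space) : P := y 0%N.

Definition coord (n : nat) (y : larger_space) : R := y n.+1.

Let polish_factors n : complete_separable (factors n).
Proof. by case: n => //= _; exact: real_line_polish. Qed.

Lemma larger_space_hausdorff : hausdorff_space larger_space.
Proof. exact: (@metric_hausdorff R (metric_prod factors)). Qed.

Lemma larger_space_lusin : lusin_topological_space R larger_space.
Proof.
split; first exact: larger_space_hausdorff.
exists (metric_prod factors), id; split => //.
- exact: (metric_prod_polish polish_factors (mk_point p0 (fun=> 0))).
- by move=> x; exact: cvg_id.
- by split=> [x _|x y _ _|x _] //; exists x.
Qed.

Lemma continuous_coord n : continuous (coord n).
Proof. exact: (@metric_prod_coord_continuous R factors n.+1). Qed.

Lemma continuous_coord0 : continuous coord0.
Proof. exact: (@metric_prod_coord_continuous R factors 0%N). Qed.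

Lemma borel_continuous (Y : topologicalType) (h : larger_space -> Y) :
  continuous h -> forall B, <<s @open Y >> B ->
  measurable (h @^-1` B : set (borelType larger_space)).
Proof.
move=> /continuousP ch.
apply: (@measurable_preimage_gen _ (borelType larger_space)) => U oU.
by apply: sub_sigma_algebra; exact: ch.
Qed.

Lemma measurable_coord n :
  measurable_fun [set: borelType larger_space] (coord n : borelType larger_space -> R).
Proof.
apply: (measurability _ (RGenOInfty.measurableE R)).
move=> _ [_ [x ->] <-]; rewrite setTI; apply: sub_sigma_algebra.
by move/continuousP: (@continuous_coord n); apply; exact: interval_open.
Qed.

Lemma larger_space_ext (y z : larger_space) :
  coord0 y = coord0 z -> (forall n, coord n y = coord n z) -> y = z.
Proof. by move=> yz0 yz; apply: functional_extensionality_dep => -[|n]//; exact: yz. Qed.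

Lemma measurable_mk_point d (X : measurableType d) (h0 : X -> P) (h : nat -> X -> R) :
  (forall B, <<s @open P >> B -> measurable (h0 @^-1` B)) ->
  (forall n, measurable_fun [set: X] (h n)) ->
  measurable_fun [set: X]
    (fun x => mk_point (h0 x) (h^~ x) : borelType larger_space).
Proof.
move=> mh0 mh _ B mB; rewrite setTI; move: B mB.
have x0 : metric_prod factors := mk_point p0 (fun=> 0).
have exa n : exists a, @dense_seq R (factors n) a.
  by apply: (separable_dense_seq (x0 n)); case: (polish_factors n).
have ha n : dense_seq (sval (cid (exa n))) by case: cid.
apply: (measurable_preimage_prod ha) => -[|n] B; first exact: mh0.
move: B; apply: measurable_preimage_gen => B oB.
rewrite -[X in measurable X]setTI; apply: (mh n) => //.
exact: open_measurable.
Qed.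

(** The separating family consists of the balls of radii [1 / (k + 1)] around
    the points of a dense sequence. *)
Lemma larger_space_separating : exists O : nat -> set (borelType larger_space),
  (forall n, measurable (O n)) /\
  (forall x y, (forall n, O n x <-> O n y) -> x = y).
Proof.
have x0 : metric_prod factors := mk_point p0 (fun=> 0).
have [sM _] := metric_prod_polish polish_factors x0.
have [a ha] := separable_dense_seq x0 sM.
pose O m := let nk := decode (0, 0)%N m in ball (a nk.1) (nk.2.+1%:R^-1 : R).
exists O; split=> [m|x y xy].
  by apply: sub_sigma_algebra; exact: (@metric_open_ball R (metric_prod factors)).
apply: (@mdist_positivity R (metric_prod factors)).
apply/eqP; rewrite eq_le mdist_ge0 andbT; apply/ler_addgt0Pl => e e0.
have e20 : 0 < e / 2 by rewrite divr_gt0.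
have [k] := ltr_add_invr e20; rewrite add0r addr0 => ke.
have k0 : 0 < k.+1%:R^-1 :> R by rewrite invr_gt0.
have [n an] := ha x _ k0; have [m hm] := decode_surj (0, 0)%N (n, k).
have := (xy m).1; rewrite /O hm => /(_ an); rewrite ballEmdist/= => ay.
move: an; rewrite ballEmdist/= => ax.
apply: le_trans (metric_triangle _ (a n) _) _; rewrite metric_sym [e]splitr lerD//.
  by apply/ltW/(lt_trans ax).
by apply/ltW/(lt_trans ay).
Qed.

Lemma compact_box (c : nat -> R) : compact
  [set y : larger_space | coord0 y = p0 /\ forall n, `|coord n y| <= c n].
Proof.
pose A n : set (factors n) := match n return set (factors n) with
  n'.+1 => [set r : R | `|r| <= c n'] | 0%N => [set p0] end.
rewrite (_ : [set y | _] = [set y : metric_prod factors | forall n, A n (y n)]).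
  apply: (@metric_prod_compact R factors) => -[|n]; first exact: compact_set1.
  rewrite /A (_ : [set r | _] = `[- c n, c n]%classic); first exact: segment_compact.
  by apply/seteqP; split=> r; rewrite /= in_itv/= ler_norml.
apply/seteqP; split=> y; first by move=> [y0 yc] [|n]; [exact: y0|exact: yc].
by move=> hy; split; [exact: (hy 0%N)|move=> n; exact: (hy n.+1)].
Qed.

End larger_space.

(** * Regularization *)

Theorem corollary3p4 (R : realType) (d : measure_display) (E : measurableType d)
  (hE : lusin_measurable_space R E)
  (mu : {sigma_finite_measure set E -> \bar R})
  (D : set (E -> R)) (eps : (E -> R) -> (E -> R) -> R)
  (heps : semi_dirichlet_form mu D eps) :
  exists (E1 : ptopologicalType) (i : E -> E1)
         (mubar : {measure set (borelType E1) -> \bar R}),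
    [/\ lusin_topological_space R E1,
        injective i /\ measurable (range i : set (borelType E1)),
        (forall A : set E, measurable A <->
           exists2 B : set (borelType E1), measurable B & A = i @^-1` B),
        extension_by_zero i mu mubar &
        semi_dirichlet_form mubar (extension_dom i mubar D)
          (extension_form i eps) /\
        quasi_regular mubar (extension_dom i mubar D)
          (extension_form i eps)].
Proof.
have [B [mB genB]] := lusin_countably_generated hE.
have [c [L2c densec]] := L2_separable mu mB genB.
have [u [bu formdense L2dense]] := countable_core heps L2c densec.
have [P [f [g [polishP [fK gK] mf mg]]]] := lusin_inverse hE.
have Du n : D (u n) by case: (bu n).
have L2u n : L2 mu (u n) by exact: (dom_L2 heps).
have mu_ n : measurable_fun [set: E] (u n) by exact: (L2_measurable (L2u n)).
have /choice[b ub] : forall n, exists b : R, forall x, `|u n x| <= b.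
  by move=> n; case: (bu n).
pose p0 := g point.
pose E1 := larger_space p0.
pose U : E -> borelType E1 := fun x => mk_point p0 (u^~ x).
pose V : E -> borelType E1 := fun x => mk_point (g x) (fun n => b n + 1).
have mU : measurable_fun [set: E] U.
  apply: measurable_mk_point => //.
  move=> B' _; rewrite (_ : _ @^-1` _ = if p0 \in B' then setT else set0).
    by case: ifP.
  by apply/seteqP; split=> x /=; case: ifPn; rewrite ?inE// => /negP + /mem_set.
have mV : measurable_fun [set: E] V by apply: measurable_mk_point.
have approxU A : measurable A -> exists2 G : set (borelType E1), measurable G &
    {ae mu, forall x, A x <-> G (U x)}.
  by move=> mA; apply: (approx_measurable L2u L2dense (@measurable_coord R P p0)).
have [Q [mQ sepQ]] := larger_space_separating p0 polishP.
have [N [mN N0 injU imgU]] := measurable_image_off_null mQ sepQ mU approxU hE.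
(* The exceptional points go to pairwise distinct points outside of the box on
   which the coordinates are bounded by the [b n]. *)
pose i x : E1 := if pselect (N x) is left _ then V x else U x.
have i_in x : N x -> i x = V x by rewrite /i; case: pselect.
have i_out x : ~ N x -> i x = U x by rewrite /i; case: pselect.
have V_U x y : V x <> U y.
  move=> /(congr1 (coord 0%N)); rewrite /coord/= => h.
  have {}h : b 0%N + 1 = u 0%N y by exact: h.
  by have := ub 0%N y; have := ler_norm (u 0%N y); lra.
have inj_i : injective i.
  move=> x y; have [Nx|Nx] := pselect (N x); have [Ny|Ny] := pselect (N y).
  - by rewrite !i_in// => /(congr1 (@coord0 R P p0)) /= /(can_inj gK).
  - by rewrite i_in// i_out// => /V_U.
  - by rewrite i_out// i_in// => /esym /V_U.
  - by rewrite !i_out//; exact: injU.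
have mi : measurable_fun [set: E] (i : E -> borelType E1).
  move=> _ A mA; rewrite setTI.
  rewrite (_ : i @^-1` A = (N `&` V @^-1` A) `|` (~` N `&` U @^-1` A)).
    apply: measurableU; apply: measurableI => //.
    - by rewrite -[X in measurable X]setTI; exact: mV.
    - exact: measurableC.
    - by rewrite -[X in measurable X]setTI; exact: mU.
  apply/seteqP; split=> x /=.
    have [Nx|Nx] := pselect (N x); first by rewrite i_in//; left.
    by rewrite i_out//; right.
  by move=> [[Nx]|[Nx]]; [rewrite i_in|rewrite i_out].
have mimg A : measurable A -> measurable (i @` A : set (borelType E1)).
  move=> mA; rewrite (_ : i @` A = (U @` (A `&` ~` N)) `|`
      (@coord0 R P p0 @^-1` (f @^-1` (A `&` N)) `&`
       \bigcap_n (@coord R P p0 n @^-1` [set b n + 1]))).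
    apply: measurableU.
      by apply: imgU; [apply: measurableI => //; exact: measurableC|move=> x []].
    apply: measurableI.
      apply: (borel_continuous (@continuous_coord0 R P p0)).
      by apply: mf; exact: measurableI.
    apply: bigcapT_measurable => n; rewrite -[X in measurable X]setTI.
    by apply: (@measurable_coord R P p0 n) => //; exact: measurable_set1.
  apply/seteqP; split=> [_ [x Ax <-]|y].
    have [Nx|Nx] := pselect (N x); [right|left].
      by rewrite i_in//; split=> [|n _]; rewrite /coord0 /coord//= gK.
    by rewrite i_out//; exists x.
  move=> [[x [Ax Nx] <-]|[[/= Ay Ny] yb]]; first by exists x => //; rewrite i_out.
  exists (f (coord0 y)) => //; rewrite i_in//.
  apply: larger_space_ext => [|n]; first by rewrite /coord0/= fK.
  exact: (esym (yb n I)).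
have aeN : {ae mu, forall x, ~ N x}.
  by exists N; split=> // x /= /contrapT.
have phi_i n : u n = coord n \o i %[ae mu].
  by apply: filterS aeN => x Nx _; rewrite /= i_out.
have mphi n : measurable_fun [set: E] (@coord R P p0 n \o i).
  exact: (measurableT_comp (@measurable_coord R P p0 n) mi).
have Dphi n : D (@coord R P p0 n \o i).
  exact: (sdf_dom_ae heps (Du n) (mphi n) (phi_i n)).
have hD := form1_semi_inner heps.
exists E1, i, (image_measure mu mi); split.
- exact: larger_space_lusin.
- by split=> //; exact: mimg.
- exact: measurable_trace.
- exact: image_measure_extension.
split; first exact: semi_dirichlet_image.
apply: (@quasi_regular_image _ _ _ _ _ _ inj_i mi mimg _ _ heps
  [set y : E1 | coord0 y = p0 /\ forall n, `|coord n y| <= b n] (@coord R P p0)).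
- exact: larger_space_hausdorff.
- exact: compact_box.
- apply: filterS aeN => x Nx; rewrite i_out//; split=> // n; exact: ub.
- exact: continuous_coord.
- exact: measurable_coord.
- exact: Dphi.
- move=> x y [x0 _] [y0 _] xy; apply: larger_space_ext => //.
  by rewrite x0 y0.
- move=> W WD Wmid Wphi.
  (* [W] contains the [u n] only up to null sets *)
  pose W' := [set v | D v /\ exists2 w, W w & v = w %[ae mu]].
  have [||n|_ dense'] := formdense W'.
  + by move=> v [].
  + move=> v1 v2 [Dv1 [w1 Ww1 vw1]] [Dv2 [w2 Ww2 vw2]]; split.
      by apply: (si_domD hD); exact: (si_domZ hD).
    exists (midpoint w1 w2); first exact: Wmid.
    apply: filterS2 vw1 vw2 => x /(_ I) h1 /(_ I) h2 _.
    by rewrite /midpoint !fctE h1 h2.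
  + by split=> //; exists (coord n \o i).
  split=> // v Dv e e0; have [v' [Dv' [w Ww v'w]] vv'] := dense' v Dv e e0.
  exists w => //; have Dw := WD _ Ww.
  rewrite -(@form1_norm_ae _ _ _ _ _ _ heps (v - v'))//.
  + exact: (si_domB hD).
  + exact: (si_domB hD).
  + by apply: filterS v'w => x /(_ I) h _; rewrite !fctE h.
Qed.
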